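(* Consider the continuous-time delayed averaging algorithm $$\dot x_i(t)=\sum_{j\in\mathcal V,\ j\ne i}a_{ij}(t)\bigl(x_j(t-h_{ij}(t))-x_i(t)\bigr),\qquad i\in\mathcal V,$$ where $\bar h\ge 0$, the weights $a_{ij}:[0,\infty)\to[0,\infty)$ are locally $L_1$-summable and the delays $h_{ij}:[0,\infty)\to[0,\bar h]$ are Lebesgue measurable. Suppose that $\sup_{t\ge 0,\ i,j\in\mathcal V}\int_t^{t+D}a_{ij}(s)\,ds<\infty$ for every finite $D>0$, and that the matrix function $A(\cdot)=(a_{ij}(\cdot))$ is aperiodically quasi-strongly connected (AQSC), with sequence $(t_p)_{p\ge0}$ as in the definition of AQSC. Then the algorithm establishes global consensus, no matter how large the delay bound $\bar h>0$ is. Furthermore, there exists a number $\theta\in(0,1)$, depending only on $A(\cdot)$ and $h_{ij}(\cdot)$, such that every solution $x$ with starting time $t_*\ge0$ and limit $\bar x=(\bar x_i)_{i\in\mathcal V}$, $\bar x_i=\lim_{t\to\infty}x_i(t)$, satisfies $$\|x(t)-\bar x\|_\infty\le\Lambda(t)-\lambda(t)\le\theta^k\bigl(\Lambda(t_* )-\lambda(t_* )\bigr)\qquad\forall k\ge 0\ \ \forall t:\ t_{r+2k(n-1)}\le t\le t_{r+2(k+1)(n-1)},$$ where $r$ is an index such that $t_r\ge t_*$ and $n=|\mathcal V|$. When $\bar h=0$ (undelayed case), the assumption that $\sup_{t\ge0,\ i,j\in\mathcal V}\int_t^{t+D}a_{ij}(s)\,ds<\infty$ for every finite $D>0$ can be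 discarded.
   Context: $\mathcal V$ is a finite set of agents, and $\|x\|_\infty=\max_i|x_i|$ for $x\in\mathbb R^{\mathcal V}$. Solutions: for a starting time $t_*\ge0$, the solution (right-continuous at $t_*$) is determined on $[t_*,\infty)$ by the initial condition $x(t_* )=x_*\in\mathbb R^{\mathcal V}$ and $x(t_*+s)=\varphi(s)$ for $s\in[-\bar h,0)$, where $\varphi\in L_\infty([-\bar h,0]\to\mathbb R^{\mathcal V})$. Global consensus: for every starting time $t_*\ge0$ and every initial condition, the limits $\bar x_i=\lim_{t\to\infty}x_i(t)$ exist for all $i\in\mathcal V$ and $\bar x_i=\bar x_j$ for all $i,j\in\mathcal V$. For a solution: $\lambda(t)=\inf_{t-\bar h\le s\le t}\min_i x_i(s)$, $\Lambda(t)=\sup_{t-\bar h\le s\le t}\max_i x_i(s)$. Graphs: for a nonnegative matrix $M=(m_{ij})_{i,j\in\mathcal V}$, the graph $\mathcal G[M]$ has node set $\mathcal V$ and an arc $(j,i)$ whenever $m_{ij}>0$. A directed graph is quasi-strongly connected if some node (a root) is connected to all other nodes by walks. $\mathcal G[M]$ is quasi-strongly $\varepsilon$-connected if the graph obtained by keeping only the arcs $(j,i)$ with $m_{ij}\ge\varepsilon$ is quasi-strongly connected. AQSC: $A(\cdot)$ is aperiodically quasi-strongly connected if there exist $\varepsilon>0$ and an increasing sequence $t_p\ge0$, $p=0,1,\dots$, $t_p\to\infty$, such that (i) for every $p$ the graph $\mathcal G\bigl[\int_{t_p}^{t_{p+1}}A(s)\,ds\bigr]$ is quasi-strongly $\varepsilon$-connected;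 (ii) $\sup_{p\ge0,\ i\ne j}\int_{t_p}^{t_{p+1}}a_{ij}(s)\,ds<\infty$.
   Formalization: For h̄>0 the estimate fails for arbitrary r with t_r≥t_*; it is stated for some r depending on t_* (uniform over solutions) for the given (t_p), and, if n≥2 or h̄=0, for every r along a subsequence of (t_p), again an AQSC sequence (all of (t_p) when h̄=0). *)

(* Defs.v *)
From HB Require Import structures.
From mathcomp Require Import all_boot all_order all_algebra.
From mathcomp Require Import all_classical all_reals all_analysis.
From mathcomp Require Import measurable_realfun.

Set Implicit Arguments.
Unset Strict Implicit.
Unset Printing Implicit Defensive.
Import Order.TTheory GRing.Theory Num.Theory.
Import numFieldNormedType.Exports.

Local Open Scope classical_set_scope.
Local Open Scope ring_scope.

(* The library's Lebesgue measure lives on the Borel sigma-algebra; Lebesgue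
   measurability is measurability for its completion. *)
Definition lebesgue_measurable_fun (R : realType) (D : set R) (f : R -> R) :=
  @measurable_fun _ _
    (g_sigma_algebraType (completed_algebra_gen (@lebesgue_measure R)))
    (measurableTypeR R) D f.

(* Integrals of nonnegative functions are suprema over simple functions from
   below, so [\int[lebesgue_measure]] is the usual Lebesgue integral also when
   the nonnegative integrand is Lebesgue but not Borel measurable. *)
Definition locally_L1 (R : realType) (f : R -> R) :=
  lebesgue_measurable_fun `[0, +oo[ f /\
  forall b : R, (\int[lebesgue_measure]_(s in `[0%R, b]) `|f s|%:E < +oo)%E.

(* [phi] is a genuine function, not an a.e.-class: the delayed argument
   [t - h i j t] may stay in a null set, so point values matter. *)
Definition Linfty (R : realType) (D : set R) (f : R -> R) :=
  lebesgue_measurable_fun D f /\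
  exists M : R, {ae lebesgue_measure, forall s : R, D s -> `|f s| <= M}.

Definition absolutely_continuous (R : realType) (b c : R) (f : R -> R) :=
  forall e : R, 0 < e -> exists2 d : R, 0 < d &
    forall (m : nat) (u v : 'I_m -> R),
      (forall k, [/\ b <= u k, u k <= v k & v k <= c]) ->
      trivIset [set: 'I_m] (fun k => `]u k, v k[%classic) ->
      \sum_k (v k - u k) < d -> \sum_k `|f (v k) - f (u k)| < e.

Section Algorithm.
Context {R : realType} {V : finType}.
Implicit Types (hbar tstar t theta : R) (a h : V -> V -> R -> R).
Implicit Types (x phi : V -> R -> R) (xstar xbar : V -> R) (tau : nat -> R).

Definition norm_infty xbar : R := \big[Num.max/0]_(i : V) `|xbar i|.

Definition weight_functions a := forall i j : V,
  (forall t, 0 <= t -> 0 <= a i j t) /\ locally_L1 (a i j).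

Definition delay_functions hbar h := forall i j : V,
  (forall t, 0 <= t -> 0 <= h i j t <= hbar) /\
  lebesgue_measurable_fun `[0, +oo[ (h i j).

Definition weight_integral a (b c : R) (i j : V) : R :=
  \int[lebesgue_measure]_(s in `[b, c]) a i j s.

Definition uniformly_bounded_windows a := forall D : R, 0 < D ->
  exists C : R, forall t, 0 <= t -> forall i j : V,
    weight_integral a t (t + D) i j <= C.

Definition quasi_strongly_connected (e : rel V) :=
  exists root : V, forall v : V, connect e root v.

Definition quasi_strongly_eps_connected (eps : R) (M : V -> V -> R) :=
  quasi_strongly_connected [rel j i | eps <= M i j].

Definition aqsc_sequence a tau :=
  [/\ 0 <= tau 0%N,
      (forall p q : nat, (p < q)%N -> tau p < tau q),
      tau p @[p --> \oo] --> +oo,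
      (exists2 eps : R, 0 < eps & forall p : nat,
         quasi_strongly_eps_connected eps
           (weight_integral a (tau p) (tau p.+1))) &
      exists C : R, forall (p : nat) (i j : V), i != j ->
        weight_integral a (tau p) (tau p.+1) i j <= C].

(* Caratheodory solution on [tstar, +oo); only the restriction of [x] to
   [tstar - hbar, +oo) is meaningful. *)
Definition solution hbar a h tstar xstar phi x :=
  [/\ (forall i : V, x i tstar = xstar i),
      (forall (i : V) (s : R), - hbar <= s < 0 -> x i (tstar + s) = phi i s),
      (forall (i : V) (T : R), absolutely_continuous tstar T (x i)) &
      {ae lebesgue_measure, forall t : R, tstar < t -> forall i : V,
        is_derive t 1 (x i)
          (\sum_(j : V | j != i) a i j t * (x j (t - h i j t) - x i t))}].

Definition initial_function hbar phi :=
  forall i : V, Linfty `[- hbar, 0[ (phi i).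

Definition global_consensus hbar a h :=
  forall tstar xstar phi x, 0 <= tstar -> initial_function hbar phi ->
    solution hbar a h tstar xstar phi x ->
    (forall i : V, cvg (x i t @[t --> +oo])) /\
    (forall i j : V, lim (x i t @[t --> +oo]) = lim (x j t @[t --> +oo])).

(* Extended reals: a function in L_oo may be unbounded on a null set. *)
Definition lower_envelope hbar x t : \bar R :=
  ereal_inf [set \big[Order.min/+oo%E]_(i : V) (x i s)%:E
            | s in `[t - hbar, t]].

Definition upper_envelope hbar x t : \bar R :=
  ereal_sup [set \big[Order.max/-oo%E]_(i : V) (x i s)%:E
            | s in `[t - hbar, t]].

Definition diameter hbar x t : \bar R :=
  (upper_envelope hbar x t - lower_envelope hbar x t)%E.

(* For hbar > 0 this cannot hold for every sequence [tau] and every [r] with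
   [tstar <= tau r]: the window [t - hbar, t] defining the diameter may still
   contain the initial function, or a node's value before its first effective
   interaction, after 2 (#|V| - 1) intervals. *)
Definition contraction_estimate hbar a h tau theta tstar (r : nat) :=
  forall xstar phi x xbar, initial_function hbar phi ->
    solution hbar a h tstar xstar phi x ->
    (forall i : V, x i t @[t --> +oo] --> xbar i) ->
    forall (k : nat) t,
      tau (r + 2 * k * (#|V| - 1))%N <= t <= tau (r + 2 * k.+1 * (#|V| - 1))%N ->
      ((norm_infty (fun i => x i t - xbar i))%:E <= diameter hbar x t)%E /\
      (diameter hbar x t <= (theta ^+ k)%:E * diameter hbar x tstar)%E.

End Algorithm.

(* Main.v *)
Require Import Defs.
From mathcomp Require Import all_boot all_order all_algebra.
From mathcomp Require Import all_classical all_reals all_analysis.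
From mathcomp Require Import measurable_realfun ring lra zify.
Set Implicit Arguments.
Unset Strict Implicit.
Unset Printing Implicit Defensive.
Import Order.TTheory GRing.Theory Num.Theory.
Import numFieldNormedType.Exports.
Local Open Scope classical_set_scope.
Local Open Scope ring_scope.

(** Why consensus holds, with a geometric rate.

    Write y' = sum_j a_ij (y_j(t - h_ij) - y_i) for the equation.  It is
    invariant under affine changes of the unknown, so any bound from below
    for nonnegative solutions can be applied both to x - lam and to Lam - x,
    where lam <= x <= Lam on the current delay window.

    Integrating factors turn the equation into such bounds.  Let W_ij be a
    primitive of a_ij and S_i the sum of the W_ij over j <> i.  If y_j >= d_j
    on [s - hbar, t], with d_j >= 0, then [comparison] says
      y_i(s) + sum_j d_j (W_ij(t) - W_ij(s)) <= y_i(t) exp(S_i(t) - S_i(s)).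
    With d = 0 this gives the maximum principle ([trajectory_ge0]: a first
    negative minimum m cannot be attained, since y - m would be nonnegative
    and positive initially) and persistence of lower bounds; with one d_j
    positive it says that a lower bound is transmitted along every arc (j, i)
    of nonnegligible integrated weight.

    Contraction.  At a given time each agent is at distance at least
    (Lam - lam)/2 from lam or from Lam.  Let I, resp. J, be the set of agents
    that stay at a definite distance above lam, resp. below Lam, throughout
    the last delay window.  Then I and J cover all agents.  Over an interval
    whose integrated graph is quasi-strongly connected, the root lies in I or
    in J; if that set is not everything, some arc leaves it, and it gains an
    agent ([floor_set_grow]).  So #|I| + #|J| grows from at least n by one per
    interval, and within n intervals I or J is everything ([floors_fill]):
    the band [lam, Lam] has shrunk by a fixed factor ([band_contraction]).

    For a set to be read off on a whole delay window, the growth interval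
    [tau_p, tau_(p+1)] has to be followed by a time of length hbar in which
    the total weight is bounded.  For hbar > 0 and n >= 2 the uniform bound on
    windows provides this: every interval carries at least eps of total weight
    between distinct agents, so a window of length hbar contains a bounded
    number of intervals, and g consecutive intervals, for a suitable g, last
    longer than hbar plus the first of them ([sampling_gap]).  For hbar = 0 one
    takes g = 1.  The subsequence sigma is p |-> g p, and n coarse intervals
    fit in 2(n-1) when n >= 2.

    The weights are only Lebesgue measurable and the solutions only absolutely
    continuous, so two facts of real analysis carry the argument:
    an absolutely continuous function with almost everywhere nonnegative
    derivative is nondecreasing ([ac_nondecreasing]), and a nonnegative locally
    integrable weight has an absolutely continuous primitive with the expected
    derivative almost everywhere ([weight_primitive]). *)

(** * Absolute continuity *)

(** Finite families of nonoverlapping segments of [b, c] are kept as lists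
    sorted from left to right: additivity over adjacent intervals is then list
    concatenation, and all estimates on such families are inductions on lists. *)
Fixpoint ordered_segments (R : realType) (b c : R) (l : seq (R * R)) : bool :=
  if l is (u, v) :: l' then [&& b <= u, u <= v & ordered_segments v c l']
  else b <= c.

Definition length_sum (R : realType) (l : seq (R * R)) : R :=
  \sum_(p <- l) (p.2 - p.1).

Definition increment_sum (R : realType) (f : R -> R) (l : seq (R * R)) : R :=
  \sum_(p <- l) `|f p.2 - f p.1|.

(** Absolute continuity on [b, c], phrased with sorted lists of segments. *)
Definition ac (R : realType) (b c : R) (f : R -> R) :=
  forall e, 0 < e -> exists2 d, 0 < d & forall l,
    ordered_segments b c l -> length_sum l < d -> increment_sum f l < e.

Lemma ordered_segments_le (R : realType) (b c : R) l :
  ordered_segments b c l -> b <= c.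
Proof.
elim: l b => [|[u v] l IH] b //= /and3P[bu uv /IH vc].
exact: le_trans bu (le_trans uv vc).
Qed.

Lemma ordered_segments_cat (R : realType) (b m c : R) l1 l2 :
  ordered_segments b m l1 -> ordered_segments m c l2 ->
  ordered_segments b c (l1 ++ l2).
Proof.
elim: l1 b => [|[u v] l1 IH] b /=.
  case: l2 => [|[u v] l2] /=; first exact: le_trans.
  by move=> bm /and3P[mu -> ->]; rewrite (le_trans bm mu).
by move=> /and3P[-> -> /IH] /=; apply.
Qed.

Lemma ordered_segments_nth (R : realType) (b c : R) l x k :
  ordered_segments b c l -> (k < size l)%N ->
  [/\ b <= (nth x l k).1, (nth x l k).1 <= (nth x l k).2 & (nth x l k).2 <= c].
Proof.
elim: l b k => [|[u v] l IH] b k //= /and3P[bu uv lvc].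
case: k => [|k] /= kl; first by rewrite bu uv (ordered_segments_le lvc).
by have [h1 h2 h3] := IH _ k lvc kl; rewrite (le_trans (le_trans bu uv) h1) h2.
Qed.

Lemma ordered_segments_nth_disj (R : realType) (b c : R) l x k k' :
  ordered_segments b c l -> (k < k')%N -> (k' < size l)%N ->
  (nth x l k).2 <= (nth x l k').1.
Proof.
elim: l b k k' => [|[u v] l IH] b k [|k'] //= /and3P[bu uv lvc].
case: k => [_ /=|k kk' kl]; last exact: (IH v).
by move=> kl; have [] := ordered_segments_nth x lvc kl.
Qed.

(** Consecutive segments of a sorted list have disjoint interiors, so they form
    one of the families quantified over by [absolutely_continuous]. *)
Lemma absolutely_continuous_ac (R : realType) (b c : R) f :
  absolutely_continuous b c f -> ac b c f.
Proof.
move=> acf e e0; have [d d0 H] := acf e e0; exists d => // l lbc ld.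
have := H (size l) (fun k => (nth (0, 0) l k).1) (fun k => (nth (0, 0) l k).2).
rewrite /length_sum (big_nth (0, 0)) big_mkord in ld.
rewrite /increment_sum (big_nth (0, 0)) big_mkord.
apply=> //; first by move=> k; exact: ordered_segments_nth lbc (ltn_ord k).
move=> i j _ _ [t /=]; rewrite !in_itv /= => -[/andP[iu iv] /andP[ju jv]].
have [ij|ji|/ord_inj//] := ltngtP i j.
- have := ordered_segments_nth_disj (0, 0) lbc ij (ltn_ord _).
  by move=> /(lt_le_trans iv) /(lt_trans ju); rewrite ltxx.
- have := ordered_segments_nth_disj (0, 0) lbc ji (ltn_ord _).
  by move=> /(lt_le_trans jv) /(lt_trans iu); rewrite ltxx.
Qed.

(** The one source of all closure properties of [ac] below: increments
    controlled linearly by increments of two absolutely continuous functions. *)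
Lemma ac_dominated (R : realType) (b c K : R) f g h :
  ac b c g -> ac b c h ->
  (forall u v, b <= u -> u <= v -> v <= c ->
    `|f v - f u| <= K * (`|g v - g u| + `|h v - h u|)) ->
  ac b c f.
Proof.
move=> acg ach dom e e0.
have K0 : 0 < `|K| + 1 by rewrite ltr_wpDl.
have e'0 : 0 < e / (`|K| + 1) / 2 by rewrite !divr_gt0.
have [d1 d10 H1] := acg _ e'0; have [d2 d20 H2] := ach _ e'0.
exists (Num.min d1 d2); first by rewrite lt_min d10.
move=> l lbc; rewrite lt_min => /andP[ld1 ld2].
have lt1 := H1 l lbc ld1; have lt2 := H2 l lbc ld2.
have -> : e = (`|K| + 1) * (e / (`|K| + 1) / 2 + e / (`|K| + 1) / 2).
  by rewrite -splitr mulrC divfK// gt_eqF.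
apply: (@le_lt_trans _ _
   ((`|K| + 1) * (increment_sum g l + increment_sum h l))); last first.
  by rewrite ltr_pM2l// ltrD.
clear - dom lbc.
elim: l b lbc dom => [|[u v] l IH] b /=.
  by move=> *; rewrite /increment_sum !big_nil addr0 mulr0.
move=> /and3P[bu uv lvc] dom.
rewrite /increment_sum !big_cons /= -!/(increment_sum _ _).
rewrite addrACA mulrDr lerD//; last first.
  apply: (IH v) => // u' v' vu' *; apply: dom => //.
  exact: le_trans bu (le_trans uv vu').
apply: le_trans (dom _ _ bu uv (ordered_segments_le lvc)) _.
by rewrite ler_wpM2r ?addr_ge0// (le_trans (ler_norm K)) ?lerDl.
Qed.

Lemma ac_subinterval (R : realType) (b c b' c' : R) f :
  b <= b' -> c' <= c -> ac b c f -> ac b' c' f.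
Proof.
move=> bb cc acf e /acf[d d0 H]; exists d => // l l'; apply: H.
case: l l' => [/= bc|]; first exact: le_trans bb (le_trans bc cc).
move=> [u v] l /= /and3P[bu -> h]; rewrite (le_trans bb bu) /=.
elim: l v h {bu} => [|[u' v'] l IH] v /= => [h|/and3P[-> -> /IH]//].
exact: le_trans h cc.
Qed.

Lemma ac_cst (R : realType) (b c k : R) : ac b c (fun _ => k).
Proof.
move=> e e0; exists 1 => // l _ _; rewrite /increment_sum big1// => p _.
by rewrite subrr normr0.
Qed.

Lemma ac_affine (R : realType) (b c k m : R) f :
  ac b c f -> ac b c (fun s => k * f s + m).
Proof.
move=> acf; apply: (@ac_dominated _ _ _ `|k| _ _ _ acf (ac_cst b c 0)).
move=> u v _ _ _; rewrite subrr normr0 addr0 -normrM.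
by rewrite (_ : _ - _ = k * (f v - f u)); last ring.
Qed.

Lemma acD (R : realType) (b c : R) f g :
  ac b c f -> ac b c g -> ac b c (fun s => f s + g s).
Proof.
move=> acf acg; apply: (@ac_dominated _ _ _ 1 _ _ _ acf acg) => u v _ _ _.
by rewrite mul1r opprD addrACA ler_normD.
Qed.

Lemma ac_sum (R : realType) (I : finType) (P : pred I) (b c : R)
    (f : I -> R -> R) :
  (forall i, ac b c (f i)) -> ac b c (fun s => \sum_(i | P i) f i s).
Proof.
move=> acf; elim: (index_enum I) => [|i r IH].
  by under eq_fun do rewrite big_nil; exact: ac_cst.
under eq_fun do rewrite big_cons.
by case: (P i) => //; exact: acD.
Qed.

(** On a compact interval both factors are bounded, and then
    d(fg) = df g + f dg is controlled by |df| + |dg|. *)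
Lemma ac_mul (R : realType) (b c K : R) f g :
  ac b c f -> ac b c g ->
  (forall s, b <= s <= c -> `|f s| <= K /\ `|g s| <= K) ->
  ac b c (fun s => f s * g s).
Proof.
move=> acf acg bnd; apply: (@ac_dominated _ _ _ K _ _ _ acf acg).
move=> u v bu uv vc.
have [_ gv] := bnd v ltac:(by rewrite (le_trans bu uv)).
have [fu _] := bnd u ltac:(by rewrite (le_trans uv vc) bu).
have -> : f v * g v - f u * g u = (f v - f u) * g v + f u * (g v - g u) by ring.
rewrite (le_trans (ler_normD _ _))// !normrM mulrDr lerD//.
  by rewrite mulrC ler_wpM2r.
by rewrite ler_wpM2r.
Qed.

Lemma ac_continuous (R : realType) (b c : R) f :
  ac b c f -> {within `[b, c], continuous f}.
Proof.
move=> acf; apply/subspace_continuousP => x /=; rewrite in_itv/= => /andP[bx xc].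
apply/cvgrPdist_lt => e e0; have [d d0 H] := acf _ e0.
rewrite near_withinE; near=> y => /=; rewrite in_itv/= => /andP[by_ yc].
have xyd : `|x - y| < d by near: y; exact: (nbhsx_ballx x d d0).
have [xy|/ltW yx] := leP x y.
  have := H [:: (x, y)]; rewrite /length_sum /increment_sum /= !big_seq1 /=.
  by rewrite bx xy yc distrC; apply=> //; rewrite -(ger0_norm (_ : 0 <= y - x)) ?subr_ge0// distrC.
have := H [:: (y, x)]; rewrite /length_sum /increment_sum /= !big_seq1 /=.
by rewrite by_ yx xc; apply=> //; rewrite -(ger0_norm (_ : 0 <= x - y)) ?subr_ge0.
Unshelve. all: by end_near. Qed.

Lemma ac_bounded (R : realType) (b c : R) f :
  ac b c f -> exists2 K : R, 0 <= K & forall s, b <= s <= c -> `|f s| <= K.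
Proof.
move=> acf; have [bc|cb] := leP b c; last first.
  exists 0 => // s /andP[bs sc].
  by have := le_lt_trans (le_trans bs sc) cb; rewrite ltxx.
have [x _ Hx] := EVT_max bc (ac_continuous acf).
have [y _ Hy] := EVT_min bc (ac_continuous acf).
exists (Num.max `|f x| `|f y|); first by rewrite le_max normr_ge0.
move=> s sbc; have s_in : s \in `[b, c] by rewrite in_itv.
rewrite ler_norml le_max (le_trans (Hx _ s_in) (ler_norm _))/= andbT.
rewrite lerNl le_max; apply/orP; right; rewrite -normrN.
by rewrite (le_trans _ (ler_norm (- f y)))// lerN2 Hy.
Qed.

(** * Monotonicity from an almost everywhere derivative *)

(** Cousin's argument: a relation on pairs of times that composes and holds
    for all short intervals around each point holds on the whole interval.
    The supremum of the times reachable from b cannot be less than c. *)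
Lemma interval_induction (R : realType) (b c : R) (P : R -> R -> Prop) :
  b <= c ->
  (forall s t u, P s t -> P t u -> P s u) ->
  (forall x, b <= x <= c -> exists2 d, 0 < d & forall s t,
     b <= s -> s <= x -> x <= t -> t <= c -> x - s < d -> t - x < d -> P s t) ->
  P b c.
Proof.
move=> bc Ptrans Ploc.
pose S := [set t | b <= t <= c /\ P b t].
have Sb : S b.
  split; first by rewrite lexx bc.
  have [|d d0 H] := Ploc b; first by rewrite lexx bc.
  by apply: H => //; rewrite subrr.
have ubS : ubound S c by move=> t [/andP[]].
have supS : has_sup S by split; [exists b | exists c].
set T := sup S.
have bT : b <= T by exact: sup_upper_bound.
have Tc : T <= c by apply: ge_sup => //; exists b.
have [|d d0 H] := Ploc T; first by rewrite bT Tc.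
have [t [/andP[bt tc] Pbt] Tdt] := sup_adherent d0 supS.
have tT : t <= T by apply: sup_upper_bound => //; split => //; rewrite bt.
pose T' := Num.min c (T + d / 2).
have TT' : T <= T' by rewrite le_min Tc lerDl divr_ge0// ltW.
have T'c : T' <= c by rewrite ge_min lexx.
have PbT' : P b T'.
  apply: Ptrans Pbt _; apply: H => //; first by rewrite ltrBlDr addrC -ltrBlDr.
  have : T' <= T + d / 2 by rewrite ge_min lexx orbT.
  by move: d0; lra.
have T'T : T' <= T.
  apply: sup_upper_bound => //.
  by split => //; rewrite (le_trans bT TT').
suff <- : T' = c by [].
apply/eqP; rewrite eq_le T'c /= leNgt; apply/negP => cT'.
have : T + d / 2 <= T'.
  by move: cT'; rewrite /T'; case: (leP c (T + d / 2)) => //; rewrite ltxx.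
by move: d0 T'T; lra.
Qed.

(** Fix e > 0 and cover the exceptional null set by an open U of measure less
    than the d that absolute continuity associates with e.  Around a point of
    the null set, take a short interval inside U as a segment of the list;
    around any other point, differentiability bounds the possible decrease by
    e times the length.  [interval_induction] glues these pieces: the segments
    of the list lie in U, so f varies by less than e on them in total, and f
    decreases by at most e (c - b) elsewhere. *)
Lemma ac_nondecreasing (R : realType) (b c : R) (f : R -> R) :
  b <= c -> ac b c f ->
  {ae lebesgue_measure, forall t : R, b < t < c ->
     exists2 m : R, 0 <= m & is_derive t 1 f m} ->
  f b <= f c.
Proof.
move=> bc acf [A [mA A0 subA]].
(* The endpoints join the null set: the derivative is only known inside. *)
pose N := A `|` [set b; c].
have mN : measurable N by do! apply: measurableU.
have N0 : lebesgue_measure N = 0%E.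
  rewrite /N setUA !measureU0//; try exact: lebesgue_measure_set1.
  exact: measurableU.
suff H e : 0 < e -> f b <= f c + e * (c - b + 1).
  apply/ler_addgt0Pr => e e0.
  have cb1 : 0 < c - b + 1 by rewrite ltr_wpDl ?subr_ge0.
  by have := H (e / (c - b + 1)); rewrite divfK ?gt_eqF//; apply; rewrite divr_gt0.
move=> e0; have [d d0 Hd] := acf e e0.
have [|||U [oU NU muU]] := @lebesgue_regularity_outer R N d => //.
  by rewrite [X in (X < _)%E]N0.
have mU : measurable U by exact: open_measurable.
have muUd : (lebesgue_measure U < d%:E)%E.
  by rewrite -(setDUK NU) setUC measureU0//; exact: measurableD.
(* Measuring U on half-open intervals makes the length bound additive. *)
pose P s t := exists l, [/\ ordered_segments s t l,
  ((length_sum l)%:E <= lebesgue_measure (U `&` `]s, t]))%E &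
  f s - f t <= e * (t - s) + increment_sum f l].
suff [l [lbc llen lvar]] : P b c.
  have := Hd l lbc; rewrite -lte_fin => /(_ _)/wrap[].
    rewrite (le_lt_trans llen)// (le_lt_trans _ muUd)//.
    by apply: le_measure; rewrite ?inE//; exact: measurableI.
  by move: lvar; lra.
apply: interval_induction => //.
- move=> s t u [l1 [ord1 len1 v1]] [l2 [ord2 len2 v2]]; exists (l1 ++ l2); split.
  + exact: ordered_segments_cat ord1 ord2.
  + have st := ordered_segments_le ord1; have tu := ordered_segments_le ord2.
    rewrite /length_sum big_cat/= EFinD.
    rewrite (_ : U `&` `]s, u] = (U `&` `]s, t]) `|` (U `&` `]t, u])); last first.
      rewrite -setIUr; congr (_ `&` _).
      by apply/seteqP; split => x /=; rewrite !in_itv/=; lra.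
    rewrite measureU/=; [|exact: measurableI|exact: measurableI|].
      exact: leeD.
    apply/seteqP; split => // x /=; rewrite !in_itv/= => -[[_ h1] [_ h2]].
    by move: h1 h2; lra.
  + by rewrite /increment_sum big_cat/= -!/(increment_sum _ _); move: v1 v2; lra.
move=> x /andP[bx xc]; have [xN|xN] := pselect (N x).
  have := oU; rewrite openE => /(_ x (NU _ xN)) /nbhs_ballP[r /= r0 xrU].
  exists r => // s t bs sx xt tc xsr txr.
  exists [:: (s, t)]; rewrite /length_sum /increment_sum !big_seq1 /=; split.
  + by rewrite lexx (le_trans sx xt) lexx.
  + rewrite (_ : U `&` `]s, t] = `]s, t]%classic); last first.
      apply/seteqP; split => [z []//|z zst]; split => //.
      apply: xrU; rewrite /ball /= ltr_norml.
      by move: zst; rewrite /= in_itv/=; lra.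
    rewrite lebesgue_measure_itv/= lte_fin; case: ltP => //.
    by rewrite lee_fin subr_le0.
  + have : 0 <= e * (t - s) by rewrite mulr_ge0 ?(ltW e0)// subr_ge0 (le_trans sx).
    by have := ler_norm (f s - f t); rewrite distrC; lra.
have {xN} : ~ (A x) /\ b < x < c.
  split; first by move=> Ax; apply: xN; left.
  rewrite !lt_neqAle bx xc !andbT; apply/andP; split.
    by apply/negP => /eqP xb; apply: xN; right; left.
  by apply/negP => /eqP xb; apply: xN; right; right.
move=> -[nAx xbc].
have {nAx} [m m0 Dx] : exists2 m : R, 0 <= m & is_derive x 1 f m.
  have : ~ ~ (b < x < c -> exists2 m : R, 0 <= m & is_derive x 1 f m).
    by move=> h; apply: nAx; apply: subA.
  by move=> /contrapT; exact.
have /cvgrPdist_le/(_ _ e0) : (fun h : R => h^-1 *: (f (h + x) - f x)) @ 0^' --> m.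
  have := @ex_derive _ _ _ _ _ _ _ Dx; rewrite /derivable => /cvg_ex[l Hl].
  have lm : l = m.
    by rewrite -(@derive_val _ _ _ _ _ _ _ Dx); apply/esym/cvg_lim.
  rewrite -lm; apply: cvg_trans Hl; apply: near_eq_cvg; near=> h.
  by rewrite [h *: 1]mulr1.
move=> /nbhs_ballP[r /= r0 Hr].
have Hr' y : `|y - x| < r -> y != x -> - e <= (f y - f x) / (y - x).
  move=> yx nyx; have := Hr (y - x); rewrite /ball/= sub0r normrN => /(_ yx).
  rewrite subr_eq0 => /(_ nyx); rewrite subrK ler_norml => /andP[_].
  by rewrite [_ *: _]mulrC; move: m0; lra.
exists r => // s t bs sx xt tc xsr txr.
exists [::]; rewrite /length_sum /increment_sum !big_nil; split => /=.
- exact: le_trans sx xt.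
- exact: measure_ge0.
have h1 : f x - f t <= e * (t - x).
  have [<-|nxt] := eqVneq x t; first by rewrite !subrr mulr0.
  have tx0 : 0 < t - x by rewrite subr_gt0 lt_neqAle nxt xt.
  have := Hr' t; rewrite gtr0_norm// eq_sym => /(_ txr nxt).
  by rewrite ler_pdivlMr//; lra.
have h2 : f s - f x <= e * (x - s).
  have [<-|nxt] := eqVneq x s; first by rewrite !subrr mulr0.
  have tx0 : 0 < x - s by rewrite subr_gt0 lt_neqAle eq_sym nxt sx.
  have := Hr' s; rewrite ltr0_norm; last by lra.
  rewrite opprB eq_sym => /(_ xsr nxt).
  by rewrite ler_ndivlMr; last lra; lra.
by lra.
Unshelve. all: by end_near. Qed.

(** * Primitives of locally integrable weights *)

(** Each superlevel set at a rational level is Borel up to a null set; removing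
    the countably many null sets at once makes all superlevel sets Borel. *)
Lemma lebesgue_borel_version (R : realType) (D : set R) (f : R -> R) :
  measurable D -> lebesgue_measurable_fun D f ->
  exists M : set R, [/\ measurable M, lebesgue_measure M = 0%E &
    measurable_fun (D `\` M) f].
Proof.
move=> mD mf.
have level (q : rat) : exists AM : set R * set R,
    [/\ measurable AM.1, measurable AM.2, lebesgue_measure AM.2 = 0%E &
      D `&` f @^-1` `]ratr q, +oo[%classic `\` AM.2 = AM.1 `\` AM.2].
  have := mf; rewrite /lebesgue_measurable_fun /measurable_fun.
  rewrite g_sigma_completed_algebra_genE => /(_ _ `]ratr q, +oo[%classic).
  case.
  - by exists D => //; exists set0; [exact: negligible_set0|rewrite setU0].
  - exact: measurable_itv.
  - move=> A mA [N [B [mB B0 NB]] AN]; exists (A, B); split => //=.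
    rewrite -AN setDUl (_ : N `\` B = set0) ?setU0//.
    by apply/seteqP; split => // x [/NB].
have [AM HAM] := choice level.
have : lebesgue_measure.-negligible
    (\bigcup_n (if unpickle n is Some q then (AM q).2 else set0)).
  apply: negligible_bigcup => n; case: unpickle => [q|]; last exact: negligible_set0.
  by have [_ m2 m0 _] := HAM q; exists (AM q).2; split.
move=> [M [mM M0 subM]]; exists M; split => //.
have subM' q : (AM q).2 `<=` M.
  by move=> x xq; apply: subM; exists (pickle q); rewrite ?pickleK.
have mDM : measurable (D `\` M) by exact: measurableD.
(* A superlevel set at a real level r is the union of those at rational
   levels q >= r. *)
apply: (@measurability _ _ _ _ _ _ _ (@RGenOInfty.measurableE R)).
move=> _ [_ [r ->] <-].
rewrite (_ : _ `&` _ =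
    \bigcup_q (if r <= ratr q then (AM q).1 `\` M else set0)).
  apply: bigcupT_measurable_rat => q; case: ifP => // _.
  by apply: measurableD => //; have [] := HAM q.
apply/seteqP; split => x /=.
- rewrite in_itv/= andbT => -[[Dx nMx] rfx].
  have [q] := rat_in_itvoo rfx; rewrite in_itv/= => /andP[rq qf].
  exists q => //; rewrite ltW//; split => //.
  have [_ _ _ eqq] := HAM q.
  have : ((AM q).1 `\` (AM q).2) x.
    rewrite -eqq; split; last by move/(subM' q).
    by split => //=; rewrite in_itv/= qf.
  by case.
- move=> [q _]; case: ifP => // rq [Aqx nMx].
  have [_ _ _ eqq] := HAM q.
  have : ((AM q).1 `\` (AM q).2) x by split => // /(subM' q).
  rewrite -eqq => -[[Dx]]; rewrite /= in_itv/= andbT => qf _.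
  by split => //; rewrite in_itv/= andbT (le_lt_trans rq).
Qed.

Import HBNNSimple.

(** The integral of a nonnegative function, measurable or not, is a supremum
    over the simple functions below it; such a simple function is almost
    everywhere below the measurable version g. *)
Lemma ge0_integral_version d (T : measurableType d) (R : realType)
    (mu : {measure set T -> \bar R}) (D M : set T) (f g : T -> \bar R) :
  measurable D -> measurable M -> mu M = 0%E -> measurable_fun D g ->
  (forall x, D x -> (0 <= g x)%E) -> (forall x, D x -> (g x <= f x)%E) ->
  (forall x, D x -> ~ M x -> f x = g x) ->
  (\int[mu]_(x in D) f x = \int[mu]_(x in D) g x)%E.
Proof.
move=> mD mM M0 mg g0 gf fg.
have f0 x : D x -> (0 <= f x)%E by move=> Dx; rewrite (le_trans (g0 _ Dx)) ?gf.
apply/eqP; rewrite eq_le; apply/andP; split; rewrite ge0_integralE//.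
  apply: ub_ereal_sup => _ [h /= hf <-].
  rewrite -integralT_nnsfun (integral_mkcond D).
  apply: ae_ge0_le_integral => //.
  - by move=> x _; rewrite lee_fin; exact: fun_ge0.
  - exact/measurable_EFinP.
  - by move=> x _; rewrite erestrict_ge0.
  - by apply/(measurable_restrictT _ mD).1.
  - exists M; split => // x /= nP; apply: contrapT => nM; apply: nP => _.
    have := hf x; rewrite !patchE; case: ifPn => // /set_mem Dx.
    by rewrite fg.
rewrite [leRHS]ge0_integralE//; apply: le_ereal_sup => _ [h /= hg <-].
exists h => //= x; rewrite (le_trans (hg x))// !patchE.
by case: ifPn => // /set_mem; exact: gf.
Qed.

Section primitive.
Variables (R : realType) (g : R -> R).
Hypothesis g0 : forall t, 0 <= g t.
Hypothesis gN : forall t : R, t < 0 -> g t = 0.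
Hypothesis mg : measurable_fun setT g.
Hypothesis gfin : forall b : R,
  (\int[lebesgue_measure]_(s in `[0%R, b]) (g s)%:E < +oo)%E.

Local Notation mu := (@lebesgue_measure R).
Let W t := \int[mu]_(s in `[0, t]) g s.

Let gint b : mu.-integrable `[0, b] (EFin \o g).
Proof.
apply/integrableP; split; first by apply/measurable_EFinP; exact: measurable_funTS.
by under eq_integral do rewrite gee0_abs ?lee_fin//.
Qed.

Lemma primitive_increment (s t : R) : 0 <= s -> s <= t ->
  W t - W s = \int[mu]_(x in `]s, t]) g x.
Proof. by move=> s0 st; rewrite Rintegral_itvB// ?bnd_simp. Qed.

Lemma primitive_increment_cc (s t : R) : 0 <= s -> s <= t ->
  W t - W s = \int[mu]_(x in `[s, t]) g x.
Proof.
move=> s0 st; rewrite primitive_increment// Rintegral_itv_obnd_cbnd//.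
apply: integrableS (gint t) => //; apply: subset_itvr.
by rewrite bnd_simp.
Qed.

Lemma primitive_nondecreasing (s t : R) : 0 <= s -> s <= t -> W s <= W t.
Proof.
move=> s0 st; rewrite -subr_ge0 primitive_increment//.
by apply: Rintegral_ge0 => x _.
Qed.

(** The sum of the increments of W over sorted segments is one integral of g,
    over their union; this is what makes absolute continuity of the integral
    applicable to W. *)
Let segments_cover (b c : R) l : 0 <= b -> ordered_segments b c l ->
  exists A : set R, [/\ measurable A, A `<=` `]b, c]%classic,
    mu A = (length_sum l)%:E &
    \int[mu]_(x in A) g x = increment_sum W l].
Proof.
elim: l b => [|[u v] l IH] b b0 /=.
  move=> _; exists set0; rewrite /length_sum /increment_sum !big_nil.
  split; [exact: measurable0|exact: sub0set|exact: measure0|].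
  exact: Rintegral_set0.
move=> /and3P[bu uv lvc].
have u0 := le_trans b0 bu; have v0 := le_trans u0 uv.
have [A [mA Av Alen Aint]] := IH v v0 lvc.
have vc := ordered_segments_le lvc.
have disj : [disjoint `]u, v]%classic & A].
  apply/eqP/seteqP; split => // x [/= + /Av/=].
  by rewrite !in_itv/= => /andP[_ xv] /andP[/(le_lt_trans xv)]; rewrite ltxx.
have uvE : mu `]u, v]%classic = (v - u)%:E.
  rewrite lebesgue_measure_itv/= lte_fin; case: ltP => // vu; congr (_%:E).
  by apply/eqP; rewrite eq_sym subr_eq0 eq_le vu uv.
exists (`]u, v]%classic `|` A); split.
- exact: measurableU.
- move=> x [|/Av]/=; rewrite !in_itv/= => /andP[h1 h2]; apply/andP; split.
  + exact: le_lt_trans bu h1.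
  + exact: le_trans h2 vc.
  + exact: le_lt_trans (le_trans bu uv) h1.
  + by [].
- rewrite measureU//; last exact/eqP.
  by rewrite [X in (_ + X)%E]Alen [X in (X + _)%E]uvE /length_sum big_cons EFinD.
- rewrite Rintegral_setU//; last first.
    apply: integrableS (gint c) => //; first exact: measurableU.
    move=> x [|/Av]/=; rewrite !in_itv/= => /andP[h1 h2]; apply/andP; split.
    + exact: ltW (le_lt_trans u0 h1).
    + exact: le_trans h2 vc.
    + exact: ltW (le_lt_trans v0 h1).
    + by [].
  rewrite Aint -primitive_increment// /increment_sum big_cons/=.
  by rewrite ger0_norm// subr_ge0 primitive_nondecreasing.
Qed.

Lemma primitive_ac (s t : R) : 0 <= s -> ac s t W.
Proof.
move=> s0 e e0.
have intT : mu.-integrable setT (EFin \o (g \_ `[0, t])).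
  rewrite -restrict_EFin.
  by apply/integrable_restrict => //=; rewrite setTI.
have [d [d0 Hd]] := integral_normr_continuous intT e0.
exists d => // l lst ld; have [A [mA As Alen Aint]] := segments_cover s0 lst.
have ltd : (mu A < d%:E)%E by rewrite Alen lte_fin.
rewrite -Aint; have := Hd A mA ltd.
congr (_ < _); apply: eq_Rintegral => x /set_mem /As.
rewrite /= in_itv/= => /andP[sx xt].
rewrite patchE ifT ?ger0_norm// mem_set//= in_itv/= xt andbT.
exact: ltW (le_lt_trans s0 sx).
Qed.

Lemma primitive_derive :
  {ae mu, forall t : R, 0 < t -> is_derive t 1 W (g t)}.
Proof.
have gint' y : mu.-integrable [set` Interval (BLeft 0) (BRight y)] (EFin \o g).
  exact: gint.
have locg : locally_integrable setT g.
  split => //; first exact: openT.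
  move=> K _ cK; have [b [_ Kb]] := compact_bounded cK.
  under eq_integral do rewrite ger0_norm//.
  have mK : measurable K by exact: compact_measurable.
  have KE : (\int[mu]_(x in K) (g x)%:E =
             \int[mu]_(x in K `&` `[0%R, (b + 1)%R]) (g x)%:E)%E.
    rewrite integral_mkcondr; apply: eq_integral => x /set_mem Kx.
    rewrite patchE; case: ifPn => // /negP; rewrite inE /= in_itv/= => xb.
    rewrite gN//; rewrite ltNge; apply/negP => x0; apply: xb.
    have xb1 : `|x| <= b + 1 by apply: (Kb (b + 1)); rewrite ?ltrDl.
    by rewrite x0 /= (le_trans (ler_norm x)).
  rewrite KE; apply: le_lt_trans (gfin (b + 1)).
  apply: ge0_subset_integral => //; first exact: measurableI.
  - by apply/measurable_EFinP; exact: measurable_funTS.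
  - by move=> x _; rewrite lee_fin.
have := FTC1 gint' locg.
apply: filterS; first exact: (ae_filter_ringOfSetsType mu).
move=> t H t0; have [|dW <-] := H; first by rewrite lte_fin.
by rewrite derive1E; exact: DeriveDef.
Qed.

End primitive.

(** What the rest of the proof knows about a weight: its integrals are the
    increments of a nondecreasing absolutely continuous function, of which it
    is the derivative almost everywhere. *)
Lemma weight_primitive (R : realType) (f : R -> R) :
  (forall t : R, 0 <= t -> 0 <= f t) -> locally_L1 f ->
  exists W : R -> R, [/\
    forall s t : R, 0 <= s -> s <= t ->
      \int[lebesgue_measure]_(x in `[s, t]) f x = W t - W s,
    forall s t : R, 0 <= s -> s <= t -> W s <= W t,
    forall s t : R, 0 <= s -> ac s t W &
    {ae lebesgue_measure, forall t : R, 0 < t -> is_derive t 1 W (f t)}].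
Proof.
move=> f0 [mf ffin].
have [M [mM M0 mfM]] := lebesgue_borel_version (measurable_itv _) mf.
set D := `[0, +oo[%classic `\` M in mfM.
have mD : measurable D by exact: measurableD.
(* A Borel function equal to f almost everywhere on the half-line, and
   below f everywhere there. *)
pose g := f \_ D.
have gE t : 0 <= t -> ~ M t -> f t = g t.
  by move=> t0 nM; rewrite /g patchE ifT// mem_set//; split => //=; rewrite in_itv/= t0.
have g0 t : 0 <= g t.
  rewrite /g patchE; case: ifPn => // /set_mem [/=].
  by rewrite in_itv/= andbT => t0 _; exact: f0.
have gf t : 0 <= t -> g t <= f t.
  by move=> t0; rewrite /g patchE; case: ifPn => // _; exact: f0.
have gN t : t < 0 -> g t = 0.
  move=> t0; rewrite /g patchE ifF//; apply/negP => /set_mem [/=].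
  by rewrite in_itv/= andbT leNgt t0.
have mg : measurable_fun setT g.
  by apply/measurable_restrict => //; rewrite setTI.
have intE s t : 0 <= s -> (\int[lebesgue_measure]_(x in `[s, t]) (f x)%:E =
    \int[lebesgue_measure]_(x in `[s, t]) (g x)%:E)%E.
  move=> s0; apply: (@ge0_integral_version _ _ _ lebesgue_measure _ M (EFin \o f) (EFin \o g)) => //.
  - by apply/measurable_EFinP; exact: measurable_funTS.
  - by move=> x _; rewrite lee_fin.
  - by move=> x /=; rewrite in_itv/= lee_fin => /andP[/(le_trans s0)/gf].
  - by move=> x /=; rewrite in_itv/= => /andP[/(le_trans s0)/gE + _ nM] => ->.
have gfin b : (\int[lebesgue_measure]_(s in `[0%R, b]) (g s)%:E < +oo)%E.
  rewrite -intE//; have := ffin b; congr (_ < _)%E.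
  apply: eq_integral => x /set_mem /=; rewrite in_itv/= => /andP[x0 _].
  by rewrite ger0_norm// f0.
exists (fun t => \int[lebesgue_measure]_(s in `[0, t]) g s); split.
- move=> s t s0 st; rewrite primitive_increment_cc//.
  by rewrite /Rintegral intE.
- exact: primitive_nondecreasing.
- by move=> s t; exact: primitive_ac.
- have := primitive_derive g0 gN mg gfin.
  have : {ae lebesgue_measure, forall t : R, ~ M t}.
    by exists M; split => // x /= /contrapT.
  apply: filterS2; first exact: (ae_filter_ringOfSetsType (@lebesgue_measure R)).
  by move=> t nM H t0; rewrite gE ?ltW//; exact: H.
Qed.

(** * Trajectories: comparison and maximum principle *)

(** On [s, t] the exponent is at most W t - W s, where exp is Lipschitz with
    constant exp (W t - W s). *)
Lemma ac_expR (R : realType) (s t : R) (W : R -> R) :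
  ac s t W -> (forall u v, s <= u -> u <= v -> v <= t -> W u <= W v) ->
  ac s t (fun u => expR (W u - W s)).
Proof.
move=> acW Wle; apply: (ac_dominated (K := expR (W t - W s)) acW (ac_cst s t 0)).
move=> u v su uv vt; rewrite subrr normr0 addr0.
have Wuv := Wle _ _ su uv vt.
rewrite !ger0_norm ?subr_ge0 ?ler_expR ?lerD2r//.
have -> : expR (W u - W s) = expR (W v - W s) * expR (- (W v - W u)).
  by rewrite -expRD; congr expR; ring.
rewrite -[X in X - _]mulr1 -mulrBr.
apply: (@le_trans _ _ (expR (W v - W s) * (W v - W u))).
  rewrite ler_wpM2l ?expR_ge0//.
  by have := expR_ge1Dx (- (W v - W u)); lra.
rewrite ler_wpM2r ?subr_ge0// ler_expR lerD2r; apply: Wle => //.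
exact: le_trans su uv.
Qed.

(** Integrating factor: the derivative of y exp(W - W s) - G is
    (y' + W' y) exp(W - W s) - G', which is nonnegative because the exponential
    is at least 1 and G' is nonnegative. *)
Lemma gronwall_lower (R : realType) (s t : R) (y W G : R -> R) :
  s <= t -> ac s t y -> ac s t W -> ac s t G ->
  (forall u v, s <= u -> u <= v -> v <= t -> W u <= W v) ->
  {ae lebesgue_measure, forall u : R, s < u < t -> exists m w g : R,
     [/\ is_derive u 1 y m, is_derive u 1 W w, is_derive u 1 G g, 0 <= g &
         g <= m + w * y u]} ->
  y s + (G t - G s) <= y t * expR (W t - W s).
Proof.
move=> st acy acW acG Wle ae_der.
have acE := ac_expR acW Wle.
have [K1 _ yK1] := ac_bounded acy; have [K2 _ EK2] := ac_bounded acE.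
have acf : ac s t (fun u => y u * expR (W u - W s) + (- 1 * G u + 0)).
  apply: acD; last exact: ac_affine.
  apply: (ac_mul (K := Num.max K1 K2)) => // u ust.
  by rewrite !le_max yK1// EK2// orbT.
have := ac_nondecreasing st acf.
rewrite subrr expR0 mulr1 => H; rewrite -subr_ge0.
suff : y s + (-1 * G s + 0) <= y t * expR (W t - W s) + (-1 * G t + 0) by lra.
apply: H; move: ae_der.
apply: filterS; first exact: (ae_filter_ringOfSetsType (@lebesgue_measure R)).
move=> u der /[dup] ust /andP[su ut].
have [m [w [g [dy dW dG g0 gle]]]] := der ust.
set E := expR (W u - W s).
have E1 : 1 <= E by rewrite -expR0 ler_expR subr_ge0 Wle// ltW.
exists ((m + w * y u) * E - g).
  rewrite subr_ge0 (le_trans gle)// ler_peMr//.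
  exact: le_trans g0 gle.
apply: is_derive_eq.
rewrite /GRing.scale /= -/E.
by ring.
Qed.

Lemma is_derive_fsum (R : realType) (I : finType) (P : pred I)
    (f : I -> R -> R) (df : I -> R) (t : R) :
  (forall i, is_derive t 1 (f i) (df i)) ->
  is_derive t 1 (fun u => \sum_(i | P i) f i u) (\sum_(i | P i) df i).
Proof.
move=> dfi; elim: (index_enum I) => [|i r IH].
  by rewrite big_nil; under eq_fun do rewrite big_nil; exact: is_derive_cst.
rewrite big_cons; under eq_fun do rewrite big_cons.
by case: (P i) => //; exact: is_deriveD.
Qed.

Section trajectories.
Variables (R : realType) (V : finType) (hbar : R).
Variables (a h W : V -> V -> R -> R).
Hypothesis hbar0 : 0 <= hbar.
Hypothesis a_ge0 : forall i j (t : R), 0 <= t -> 0 <= a i j t.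
Hypothesis h_bnd : forall i j (t : R), 0 <= t -> 0 <= h i j t <= hbar.
Hypothesis W_le : forall i j (s t : R), 0 <= s -> s <= t -> W i j s <= W i j t.
Hypothesis W_ac : forall i j (s t : R), 0 <= s -> ac s t (W i j).
Hypothesis W_derive : forall i j,
  {ae lebesgue_measure, forall t : R, 0 < t -> is_derive t 1 (W i j) (a i j t)}.

Implicit Types (x y : V -> R -> R) (s t T : R).

(** The part of [solution] that survives a later restart; the past of x before
    t0 enters only through bounds on its values. *)
Definition trajectory t0 x :=
  (forall i T, ac t0 T (x i)) /\
  {ae lebesgue_measure, forall t : R, t0 < t -> forall i,
     is_derive t 1 (x i)
       (\sum_(j | j != i) a i j t * (x j (t - h i j t) - x i t))}.

Definition inflow (i : V) t := \sum_(j | j != i) W i j t.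

Lemma inflow_le i s t : 0 <= s -> s <= t -> inflow i s <= inflow i t.
Proof. by move=> s0 st; apply: ler_sum => j _; exact: W_le. Qed.

Lemma trajectory_restart t0 t1 x :
  t0 <= t1 -> trajectory t0 x -> trajectory t1 x.
Proof.
move=> t01 [acx dx]; split.
  by move=> i T; apply: ac_subinterval (acx i T).
move: dx; apply: filterS.
  exact: (ae_filter_ringOfSetsType (@lebesgue_measure R)).
by move=> t H t1t; apply: H; exact: le_lt_trans t1t.
Qed.

(** The coefficients multiply differences of values, so constants cancel. *)
Lemma trajectory_affine t0 x (k m : R) :
  trajectory t0 x -> trajectory t0 (fun i s => k * x i s + m).
Proof.
move=> [acx dx]; split; first by move=> i T; exact: ac_affine.
move: dx; apply: filterS.
  exact: (ae_filter_ringOfSetsType (@lebesgue_measure R)).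
move=> t H t0t i; have Hi := H t0t i; apply: is_derive_eq.
rewrite addr0 scaler_sumr; apply: eq_bigr => j _.
by rewrite /GRing.scale /=; ring.
Qed.

Lemma ae_all (P : V -> R -> Prop) :
  (forall i, {ae lebesgue_measure, forall t : R, P i t}) ->
  {ae lebesgue_measure, forall t : R, forall i, P i t}.
Proof.
move=> H.
have [N HN] := choice H.
have : (@lebesgue_measure R).-negligible (\bigcup_(n in [set: nat])
    (if unpickle n is Some i then N i else set0)).
  apply: negligible_bigcup => n; case: unpickle => [i|].
    by have [mN N0 _] := HN i; exists (N i); split.
  exact: negligible_set0.
apply: negligibleS => t /= nP.
have [i nPi] : exists i, ~ P i t by apply/existsNP.
have [_ _ subN] := HN i.
by exists (pickle i); rewrite ?pickleK//; apply: subN.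
Qed.

(** [gronwall_lower] with the total incoming weight as the decay rate: what the
    delayed values y_j >= d_j contribute is at least the sum of the d_j a_ij. *)
Lemma comparison t0 y s t (i : V) (d : V -> R) :
  0 <= t0 -> trajectory t0 y -> t0 <= s -> s <= t ->
  (forall j, 0 <= d j) ->
  (forall j u, s - hbar <= u -> u <= t -> d j <= y j u) ->
  y i s + \sum_(j | j != i) d j * (W i j t - W i j s) <=
  y i t * expR (inflow i t - inflow i s).
Proof.
move=> t00 [acy dy] t0s st d0 dle; have s0 := le_trans t00 t0s.
pose G u := \sum_(j | j != i) (d j * W i j u + 0).
have -> : \sum_(j | j != i) d j * (W i j t - W i j s) = G t - G s.
  by rewrite /G -sumrB; apply: eq_bigr => j _; ring.
apply: gronwall_lower => //.
- exact: ac_subinterval (acy i t).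
- by apply: ac_sum => j; exact: W_ac.
- by apply: ac_sum => j; apply: ac_affine; exact: W_ac.
- by move=> u v su uv _; apply: inflow_le => //; exact: le_trans su.
have dW := ae_all (fun i => ae_all (W_derive i)).
move: dW dy; apply: filterS2.
  exact: (ae_filter_ringOfSetsType (@lebesgue_measure R)).
move=> u dW dy /andP[su ut].
have u0 := le_lt_trans s0 su.
have dyi := dy (le_lt_trans t0s su) i.
have dWi j : is_derive u 1 (W i j) (a i j u) := dW i j u0.
exists (\sum_(j | j != i) a i j u * (y j (u - h i j u) - y i u)).
exists (\sum_(j | j != i) a i j u), (\sum_(j | j != i) d j * a i j u).
split=> //.
- exact: is_derive_fsum.
- apply: is_derive_fsum => j; apply: is_derive_eq.
  by rewrite addr0 /GRing.scale.
- by apply: sumr_ge0 => j _; rewrite mulr_ge0// a_ge0// ltW.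
- rewrite mulr_suml -big_split/=; apply: ler_sum => j _.
  rewrite -mulrDr subrK mulrC ler_wpM2l ?a_ge0 ?(ltW u0)//.
  have /andP[h0 hh] := h_bnd i j (ltW u0).
  by apply: dle; lra.
Qed.

(** Maximum principle.  Let m be the least value taken by any agent on [t0, T],
    reached by k at time c, and suppose m < 0.  All agents stay above m up to
    c, so [comparison] for y - m on [t0, c] gives y_k(t0) - m <= 0, although
    y_k(t0) is nonnegative. *)
Lemma trajectory_ge0 t0 y :
  0 <= t0 -> trajectory t0 y ->
  (forall j u, t0 - hbar <= u -> u <= t0 -> 0 <= y j u) ->
  forall i t, t0 <= t -> 0 <= y i t.
Proof.
move=> t00 trj y0 i T t0T.
have argmin k : exists2 c, t0 <= c <= T &
    forall u, t0 <= u <= T -> y k c <= y k u.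
  have [c cin Hc] := EVT_min t0T (ac_continuous (trj.1 k T)).
  exists c; first by rewrite in_itv/= in cin.
  by move=> u uin; apply: Hc; rewrite in_itv.
have [c Hc'] := choice (fun k => (fun '(ex_intro2 c p q) =>
   ex_intro (fun c => t0 <= c <= T /\ forall u, t0 <= u <= T -> y k c <= y k u)
     c (conj p q)) (argmin k)).
have [k _ kmin] := @Order.TotalTheory.arg_minP _ _ _ i xpredT (fun k => y k (c k)) isT.
have [/andP[t0c cT] _] := Hc' k.
have [m0|m0] := leP 0 (y k (c k)).
  apply: le_trans m0 _; apply: le_trans (kmin i isT) _.
  by apply: (Hc' i).2; rewrite t0T lexx.
have := @comparison t0 (fun i s => 1 * y i s + - y k (c k)) t0 (c k) k
  (fun _ => 0) t00 (trajectory_affine _ _ trj) (lexx _) t0c (fun _ => lexx _).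
rewrite big1; last by move=> j _; rewrite mul0r.
rewrite /= !mul1r subrr mul0r addr0 => /(_ _)/wrap[].
  move=> j u ut uc; rewrite mul1r subr_ge0.
  have [ut0|t0u] := leP u t0; first by rewrite (le_trans (ltW m0)) ?y0.
  apply: le_trans (kmin j isT) _; apply: (Hc' j).2.
  by rewrite (ltW t0u) (le_trans uc).
have := y0 k t0; rewrite lexx lerBlDr lerDl => /(_ hbar0 isT).
by lra.
Qed.

(** * Bands and the transmission of lower bounds along arcs *)

Definition in_band x t (lam Lam : R) :=
  forall i s, t - hbar <= s -> s <= t -> lam <= x i s <= Lam.

Lemma in_band_forever t0 s x lam Lam :
  0 <= t0 -> trajectory t0 x -> t0 <= s -> in_band x s lam Lam ->
  forall i t, s - hbar <= t -> lam <= x i t <= Lam.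
Proof.
move=> t00 /trajectory_restart trs t0s band i t st.
have s0 := le_trans t00 t0s; have trx := trs s t0s.
have [/band H|/ltW st'] := leP t s; first exact: H.
apply/andP; split.
- have := trajectory_ge0 s0 (trajectory_affine 1 (- lam) trx) _ i st'.
  rewrite /= mul1r subr_ge0; apply => j u u1 u2.
  by rewrite mul1r subr_ge0; have /andP[] := band j u u1 u2.
- have := trajectory_ge0 s0 (trajectory_affine (- 1) Lam trx) _ i st'.
  rewrite /= mulN1r [_ + Lam]addrC subr_ge0; apply => j u u1 u2.
  by rewrite mulN1r [_ + Lam]addrC subr_ge0; have /andP[] := band j u u1 u2.
Qed.

Lemma in_band_later t0 s t x lam Lam :
  0 <= t0 -> trajectory t0 x -> t0 <= s -> s <= t -> in_band x s lam Lam ->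
  in_band x t lam Lam.
Proof.
move=> t00 trx t0s st band i u tu _; apply: (in_band_forever t00 trx t0s band).
by rewrite (le_trans _ tu)// lerD2r.
Qed.

(** A nonnegative agent forgets its value at most at the rate of its total
    incoming weight, of which it receives at most C. *)
Lemma persistence t0 y s t i (C d : R) :
  0 <= t0 -> trajectory t0 y -> t0 <= s -> s <= t ->
  (forall j u, s - hbar <= u -> u <= t -> 0 <= y j u) ->
  inflow i t - inflow i s <= C -> d <= y i s -> expR (- C) * d <= y i t.
Proof.
move=> t00 trj t0s st y0 SC dy.
have := comparison i t00 trj t0s st (fun _ => lexx 0) y0.
rewrite big1; last by move=> j _; rewrite mul0r.
rewrite addr0 => cmp.
have yt0 : 0 <= y i t by apply: y0 => //; rewrite (le_trans _ st)// gerBl.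
rewrite expRN mulrC ler_pdivrMr ?expR_gt0// (le_trans dy)// (le_trans cmp)//.
by rewrite ler_wpM2l// ler_expR.
Qed.

(** An arc of integrated weight eps hands the lower bound of its tail over to
    its head, discounted by what the head forgets in the meantime. *)
Lemma transmission t0 y s t i j (C eps d : R) :
  0 <= t0 -> trajectory t0 y -> t0 <= s -> s <= t -> j != i -> 0 <= d ->
  (forall k u, s - hbar <= u -> u <= t -> 0 <= y k u) ->
  (forall u, s - hbar <= u -> u <= t -> d <= y j u) ->
  inflow i t - inflow i s <= C -> eps <= W i j t - W i j s ->
  expR (- C) * (eps * d) <= y i t.
Proof.
move=> t00 trj t0s st ji d0 y0 yd SC epsW.
pose dd k : R := if k == j then d else 0.
have dd0 k : 0 <= dd k by rewrite /dd; case: ifP.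
have := comparison i t00 trj t0s st dd0 _ => /(_ _)/wrap[].
  by move=> k u su ut; rewrite /dd; case: eqP => [->|_]; [exact: yd|exact: y0].
rewrite (bigD1 j)//= big1 ?addr0; last first.
  by move=> k /andP[_ /negbTE kj]; rewrite /dd kj mul0r.
rewrite /dd eqxx => cmp.
have yt0 : 0 <= y i t by apply: y0 => //; rewrite (le_trans _ st)// gerBl.
have ys0 : 0 <= y i s by apply: y0 => //; rewrite gerBl.
rewrite expRN mulrC ler_pdivrMr ?expR_gt0//.
apply: le_trans (_ : y i t * expR (inflow i t - inflow i s) <= _); last first.
  by rewrite ler_wpM2l// ler_expR.
by apply: le_trans cmp; rewrite mulrC -[leLHS]add0r lerD// ler_wpM2l.
Qed.

(** The bound is required on a whole delay window, since these are the values
    that the neighbours read afterwards. *)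
Definition floor_set y t (d : R) : {set V} :=
  [set i | `[< forall s, t - hbar <= s -> s <= t -> d <= y i s >]].

Lemma floor_setP y t d i :
  reflect (forall s, t - hbar <= s -> s <= t -> d <= y i s)
          (i \in floor_set y t d).
Proof. by rewrite inE; exact: asboolP. Qed.

(** A walk that ends outside S leaves S at some arc. *)
Lemma connect_exit (e : rel V) (S : {set V}) r :
  r \in S -> (forall v, connect e r v) -> S != [set: V]%SET ->
  exists j i, [/\ j \in S, i \notin S & e j i].
Proof.
move=> rS rconn; rewrite -finset.subTset => /subsetPn[v _ vS].
have /connectP[p] := rconn v.
elim: p r rS {rconn} => [|w p IH] r rS /= => [_ vr|/andP[rw pw] vlast].
  by rewrite vr rS in vS.
have [wS|wS] := boolP (w \in S); first exact: IH wS pw vlast.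
by exists r, w.
Qed.

Section coarse_step.
Variables (C eps : R).
Hypothesis eps0 : 0 < eps.

(** The discount over one coarse interval [t1, t3].  The tail of an arc decays
    during the growth phase [t1, t2], its bound is transmitted to the head at
    time t2 with factor expR (- C) * eps, and the head decays until t3; agents
    that already belong to the set only decay, which costs less. *)
Definition step_factor := expR (- C) * expR (- C) * Num.min 1 (expR (- C) * eps).

Hypothesis C0 : 0 <= C.

Lemma step_factor_gt0 : 0 < step_factor.
Proof. by rewrite !mulr_gt0 ?expR_gt0// lt_min ltr01 mulr_gt0 ?expR_gt0. Qed.

Lemma step_factor_le1 : step_factor <= 1.
Proof.
have e1 : expR (- C) <= 1 by rewrite -expR0 ler_expR oppr_le0.
rewrite /step_factor mulr_ile1 ?mulr_ge0 ?expR_ge0 ?le_min ?ler01 ?mulr_ge0 ?expR_ge0 ?(ltW eps0)//.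
  by rewrite mulr_ile1 ?expR_ge0.
by rewrite ge_min lexx.
Qed.

Variables (t0 : R) (y : V -> R -> R) (t1 t2 t3 : R).
Hypothesis t00 : 0 <= t0.
Hypothesis trj : trajectory t0 y.
Hypothesis t01 : t0 <= t1.
Hypothesis t12 : t1 <= t2.
Hypothesis t23 : t2 + hbar <= t3.
Hypothesis inflowC : forall i, inflow i t3 - inflow i t1 <= C.
Hypothesis y0 : forall i s, t1 - hbar <= s -> 0 <= y i s.

Let inflow_sub i s t : t1 <= s -> s <= t -> t <= t3 ->
  inflow i t - inflow i s <= C.
Proof.
move=> t1s st tt3; apply: le_trans (inflowC i).
have t10 := le_trans t00 t01.
have h1 := inflow_le i t10 t1s.
have h2 := inflow_le i (le_trans t10 (le_trans t1s st)) tt3.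
by lra.
Qed.

(** The flush phase [t2, t3] covers the delay window that ends at t3, so a bound
    at the single instant t1 becomes a bound on that window. *)
Lemma floor_set_persist i d : 0 <= d -> d <= y i t1 ->
  i \in floor_set y t3 (step_factor * d).
Proof.
move=> d0 di; apply/floor_setP => s s1 s2.
have t1s : t1 <= s by move: t12 t23 s1; lra.
apply: le_trans (persistence (C := C) t00 trj t01 t1s _ _ di).
- rewrite ler_wpM2r// /step_factor -mulrA ger_pMr ?expR_gt0//.
  rewrite mulr_ile1 ?expR_ge0 ?le_min ?ler01 ?mulr_ge0 ?expR_ge0 ?(ltW eps0)//.
    by rewrite -expR0 ler_expR oppr_le0.
  by rewrite ge_min lexx.
- by move=> j u u1 _; exact: y0.
- exact: inflow_sub.
Qed.

Lemma floor_set_sub d : 0 <= d ->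
  floor_set y t1 d \subset floor_set y t3 (step_factor * d).
Proof.
move=> d0; apply/fintype.subsetP => i /floor_setP di; apply: floor_set_persist => //.
by apply: di; rewrite ?gerBl.
Qed.

(** If the set is not everything, the root reaches outside it, so some heavy arc
    leaves the set and recruits its head. *)
Lemma floor_set_grow d r : 0 <= d ->
  (forall v, connect [rel j i | eps <= W i j t2 - W i j t1] r v) ->
  r \in floor_set y t1 d -> floor_set y t1 d != [set: V]%SET ->
  (#|floor_set y t1 d| < #|floor_set y t3 (step_factor * d)|)%N.
Proof.
move=> d0 rconn rI In.
have [j [i [jI iI /= eps_ij]]] := connect_exit rI rconn In.
apply: proper_card; apply/properP; split; first exact: floor_set_sub.
exists i => //; apply/floor_setP => s s1 s2.
have jP := elimT (floor_setP _ _ _ _) jI.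
have ji : j != i by apply/eqP => ji; rewrite ji (negbTE iI) in jI.
have t23' : t2 <= t3 by rewrite (le_trans _ t23)// lerDl.
have e0 : 0 < expR (- C) by exact: expR_gt0.
have e1 : expR (- C) <= 1 by rewrite -expR0 ler_expR oppr_le0.
have yj u : t1 - hbar <= u -> u <= t2 -> expR (- C) * d <= y j u.
  move=> u1 u2; have [ut1|/ltW t1u] := leP u t1.
    by apply: le_trans (jP _ u1 ut1); rewrite ler_piMl.
  apply: (persistence (C := C) t00 trj t01 t1u).
  - by move=> k v v1 _; exact: y0.
  - by apply: inflow_sub => //; exact: le_trans t23'.
  - by apply: jP; rewrite ?gerBl.
have yi2 := transmission (C := C) t00 trj t01 t12 ji
  (mulr_ge0 (ltW e0) d0) (fun k u u1 _ => y0 k u1) yj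
  (inflow_sub i (lexx _) t12 t23') eps_ij.
have t2s : t2 <= s by move: t23 s1; lra.
apply: le_trans (persistence (C := C) t00 trj (le_trans t01 t12) t2s _ _ yi2).
- rewrite /step_factor -!mulrA ler_pM2l// ler_pM2l//.
  apply: le_trans (_ : (expR (- C) * eps) * d <= _).
    by rewrite ler_wpM2r// ge_min lexx orbT.
  by rewrite -mulrA mulrCA.
- by move=> k u u1 _; apply: y0; rewrite (le_trans _ u1)// lerD2r.
- by apply: inflow_sub.
Qed.

End coarse_step.

(** * Contraction of bands *)

(** The p-th coarse interval consists of a growth phase [T p, T' p], over which
    the integrated graph is connected, and of a flush phase of length at least
    hbar. *)
Definition coarse_times (C eps : R) (T T' : nat -> R) :=
  forall p, [/\ T p <= T' p, T' p + hbar <= T p.+1,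
    forall i, inflow i (T p.+1) - inflow i (T p) <= C &
    quasi_strongly_connected
      [rel j i | eps <= W i j (T' p) - W i j (T p)]].

Lemma coarse_times_le (C eps : R) (T T' : nat -> R) p q :
  coarse_times C eps T T' -> (p <= q)%N -> T p <= T q.
Proof.
move=> cT; elim: q => [|q IH]; first by rewrite leqn0 => /eqP ->.
rewrite leq_eqVlt => /predU1P[-> //|/IH Tpq].
have [TT' T'T _ _] := cT q.
by apply: le_trans Tpq (le_trans TT' (le_trans _ T'T)); rewrite lerDl.
Qed.

(** After #|V| coarse intervals the half-width (Lam - lam) / 2 survives, on one
    side of the band, with one [step_factor] per interval. *)
Definition contraction_factor (C eps : R) : R :=
  1 - step_factor C eps ^+ #|V| / 2.

Lemma contraction_factor_bounds (C eps : R) :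
  0 < eps -> 0 <= C -> 0 < contraction_factor C eps < 1.
Proof.
move=> eps0 C0; have k0 := step_factor_gt0 C eps0.
have k1 := step_factor_le1 eps0 C0.
have := exprn_gt0 #|V| k0; have := exprn_ile1 #|V| (ltW k0) k1.
by rewrite /contraction_factor; lra.
Qed.

(** After the first coarse interval the two sets cover all agents, since every
    agent is in the upper or in the lower half of the band at time T 0.  From
    then on each interval enlarges one of them: the root is in one of them. *)
Lemma floors_fill (C eps lam Lam : R) t0 x (T T' : nat -> R) q :
  0 < eps -> 0 <= C -> 0 <= t0 -> trajectory t0 x -> t0 <= T 0%N ->
  coarse_times C eps T T' -> lam <= Lam -> in_band x (T 0%N) lam Lam ->
  let d := step_factor C eps ^+ q.+1 * ((Lam - lam) / 2) in
  let I := floor_set (fun i s => 1 * x i s + - lam) (T q.+1) d in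
  let J := floor_set (fun i s => - 1 * x i s + Lam) (T q.+1) d in
  I :|: J = [set: V]%SET /\
  [\/ I = [set: V]%SET, J = [set: V]%SET | (#|V| + q <= #|I| + #|J|)%N].
Proof.
move=> eps0 C0 t00 trx t0T cT lamLam band.
set y := fun i s => 1 * x i s + - lam; set z := fun i s => - 1 * x i s + Lam.
have try : trajectory t0 y by exact: trajectory_affine.
have trz : trajectory t0 z by exact: trajectory_affine.
have t0Tp p : t0 <= T p by apply: le_trans t0T (coarse_times_le cT _).
have bandp p i s : T p - hbar <= s -> lam <= x i s <= Lam.
  move=> ps; apply: (in_band_forever t00 trx t0T band).
  by rewrite (le_trans _ ps)// lerD2r (coarse_times_le cT).
have y0 p i s : T p - hbar <= s -> 0 <= y i s.
  by move=> /(bandp p i)/andP[? _]; rewrite /y mul1r subr_ge0.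
have z0 p i s : T p - hbar <= s -> 0 <= z i s.
  by move=> /(bandp p i)/andP[_ ?]; rewrite /z mulN1r addrC subr_ge0.
have k0 := step_factor_gt0 C eps0.
elim: q => [|q]; rewrite /=.
  rewrite expr1; set I := floor_set y _ _; set J := floor_set z _ _.
  have IJ : I :|: J = [set: V]%SET.
    apply/setP => i; rewrite finset.inE finset.in_setT; apply/orP.
    have [c1 c2 c3 _] := cT 0%N.
    have D0 : 0 <= (Lam - lam) / 2 by rewrite divr_ge0// subr_ge0.
    have [le_x|/ltW x_le] := leP ((Lam + lam) / 2) (x i (T 0%N)).
      left; apply: (floor_set_persist eps0 C0 t00 try t0T c1 c2 c3 (y0 _)) => //.
      by rewrite /y; lra.
    right; apply: (floor_set_persist eps0 C0 t00 trz t0T c1 c2 c3 (z0 _)) => //.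
    by rewrite /z; lra.
  split => //; apply: Or33; rewrite addn0.
  by rewrite -cardsUI IJ cardsT leq_addr.
set d := _ ^+ q.+1 * _; set I := floor_set y _ d; set J := floor_set z _ d.
rewrite exprS -mulrA -/d.
set I' := floor_set y _ _; set J' := floor_set z _ _ => -[IJ fill].
have d0 : 0 <= d.
  by rewrite mulr_ge0 ?exprn_ge0 ?divr_ge0 ?subr_ge0// ltW.
have [c1 c2 c3 [r rconn]] := cT q.+1.
have II' : I \subset I'.
  exact: (floor_set_sub eps0 C0 t00 try (t0Tp _) c1 c2 c3 (y0 _) d0).
have JJ' : J \subset J'.
  exact: (floor_set_sub eps0 C0 t00 trz (t0Tp _) c1 c2 c3 (z0 _) d0).
split.
  by apply/eqP; rewrite -finset.subTset -IJ finset.setUSS.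
have [IT|IT] := eqVneq I [set: V]%SET.
  by apply: Or31; apply/eqP; rewrite -finset.subTset -IT.
have [JT|JT] := eqVneq J [set: V]%SET.
  by apply: Or32; apply/eqP; rewrite -finset.subTset -JT.
case: fill => [/eqP|/eqP|]; rewrite ?(negbTE IT) ?(negbTE JT)// => fill.
apply: Or33; rewrite addnS; apply: leq_ltn_trans fill _.
have : r \in I :|: J by rewrite IJ finset.in_setT.
rewrite finset.inE => /orP[rI|rJ].
- rewrite -addSn leq_add ?(subset_leq_card JJ')//.
  exact: (floor_set_grow eps0 C0 t00 try (t0Tp _) c1 c2 c3 (y0 _) d0 rconn rI IT).
- rewrite -addnS leq_add ?(subset_leq_card II')//.
  exact: (floor_set_grow eps0 C0 t00 trz (t0Tp _) c1 c2 c3 (z0 _) d0 rconn rJ JT).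
Qed.

Lemma band_contraction (C eps lam Lam : R) t0 x (T T' : nat -> R) :
  0 < eps -> 0 <= C -> 0 <= t0 -> trajectory t0 x -> t0 <= T 0%N ->
  coarse_times C eps T T' -> lam <= Lam -> in_band x (T 0%N) lam Lam ->
  exists lam' Lam',
    in_band x (T #|V|) lam' Lam' /\
    Lam' - lam' = contraction_factor C eps * (Lam - lam).
Proof.
move=> eps0 C0 t00 trx t0T cT lamLam band.
have V0 : (0 < #|V|)%N by have [_ _ _ [r _]] := cT 0%N; apply/card_gt0P; exists r.
have [_] := floors_fill #|V|.-1 eps0 C0 t00 trx t0T cT lamLam band.
rewrite prednK//; set d := _ * ((Lam - lam) / 2).
set I := floor_set _ _ _; set J := floor_set _ _ _ => fill.
have bandV i s : T #|V| - hbar <= s -> lam <= x i s <= Lam.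
  move=> ps; apply: (in_band_forever t00 trx t0T band).
  by rewrite (le_trans _ ps)// lerD2r (coarse_times_le cT).
have [IT|JT] : I = [set: V]%SET \/ J = [set: V]%SET.
  case: fill => [||sz]; [by left|by right|].
  have [IT|IT] := eqVneq I [set: V]%SET; first by left.
  right; apply/eqP; rewrite finset.eqEcard finset.subsetT cardsT.
  have : (#|I| < #|V|)%N by rewrite -cardsT proper_card// finset.properEneq IT finset.subsetT.
  by move: sz; rewrite /=; lia.
- exists (lam + d), Lam; split.
  + move=> i s s1 s2; have /andP[_ ->] := bandV i s s1; rewrite andbT.
    have /floor_setP/(_ s s1 s2) : i \in I by rewrite IT finset.in_setT.
    by rewrite /=; lra.
  + by rewrite /contraction_factor /d; field.
- exists lam, (Lam - d); split.
  + move=> i s s1 s2; have /andP[-> _] := bandV i s s1; rewrite /=.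
    have /floor_setP/(_ s s1 s2) : i \in J by rewrite JT finset.in_setT.
    by rewrite /=; lra.
  + by rewrite /contraction_factor /d; field.
Qed.

Lemma band_iterate (C eps lam Lam : R) t0 x (T T' : nat -> R) (N k : nat) :
  0 < eps -> 0 <= C -> 0 <= t0 -> trajectory t0 x -> t0 <= T 0%N ->
  coarse_times C eps T T' -> lam <= Lam -> in_band x (T 0%N) lam Lam ->
  (#|V| <= N)%N ->
  exists lam' Lam', in_band x (T (k * N)%N) lam' Lam' /\
    Lam' - lam' = contraction_factor C eps ^+ k * (Lam - lam).
Proof.
move=> eps0 C0 t00 trx t0T cT lamLam band VN.
elim: k => [|k [lam1 [Lam1 [band1 width1]]]].
  by exists lam, Lam; rewrite expr0 mul1r.
have /andP[th0 _] := contraction_factor_bounds eps0 C0.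
have t0Tk : t0 <= T (k * N + 0)%N by exact: le_trans t0T (coarse_times_le cT _).
have cTk : coarse_times C eps (fun p => T (k * N + p)%N) (fun p => T' (k * N + p)%N).
  by move=> p; have := cT (k * N + p)%N; rewrite -addnS.
have lamLam1 : lam1 <= Lam1.
  rewrite -subr_ge0 width1; apply: mulr_ge0; first exact/exprn_ge0/ltW.
  by rewrite subr_ge0.
have := band_contraction eps0 C0 t00 trx t0Tk cTk lamLam1.
rewrite addn0 => /(_ band1)[lam2 [Lam2 [band2 width2]]].
exists lam2, Lam2; split; last by rewrite width2 width1 exprS mulrA.
have t0Tn : t0 <= T (k * N + #|V|)%N by exact: le_trans t0T (coarse_times_le cT _).
apply: in_band_later t00 trx t0Tn _ band2; apply: coarse_times_le cT _.
by rewrite mulSn addnC leq_add2r.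
Qed.

(** * Extraction of coarse intervals *)

Section sampling.
Variables (tau : nat -> R) (eps C0 : R).
Hypothesis eps0 : 0 < eps.
Hypothesis tau0 : 0 <= tau 0%N.
Hypothesis tau_lt : forall p q, (p < q)%N -> tau p < tau q.
Hypothesis tau_connected : forall p,
  quasi_strongly_connected [rel j i | eps <= W i j (tau p.+1) - W i j (tau p)].

Lemma tau_le p q : (p <= q)%N -> tau p <= tau q.
Proof. by rewrite leq_eqVlt => /predU1P[-> //|/tau_lt/ltW]. Qed.

Lemma tau_ge0 p : 0 <= tau p.
Proof. exact: le_trans tau0 (tau_le _). Qed.

Lemma sampled_weight_le p g i j :
  (forall p, W i j (tau p.+1) - W i j (tau p) <= C0) ->
  W i j (tau (p + g)) - W i j (tau p) <= g%:R * C0.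
Proof.
move=> WC0; elim: g => [|g IH]; first by rewrite addn0 subrr mul0r.
by rewrite addnS mulrSr mulrDl mul1r; have := WC0 (p + g)%N; lra.
Qed.

Lemma sampled_coarse_times g q :
  0 <= C0 ->
  (forall p i j, i != j -> W i j (tau p.+1) - W i j (tau p) <= C0) ->
  (forall p, tau p.+1 + hbar <= tau (p + g)%N) ->
  coarse_times (#|V|%:R * (g%:R * C0)) eps
    (fun p => tau (g * (q + p))%N) (fun p => tau (g * (q + p)).+1%N).
Proof.
move=> C00 WC0 tau_g p; split.
- exact: tau_le.
- by rewrite addnS mulnS [(g + _)%N]addnC; exact: tau_g.
- move=> i; rewrite /inflow -sumrB addnS mulnS [(g + _)%N]addnC.
  apply: le_trans (_ : \sum_(j | j != i) g%:R * C0 <= _).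
    apply: ler_sum => j ji; apply: sampled_weight_le => p'.
    by apply: WC0; rewrite eq_sym.
  rewrite sumr_const -[leLHS]mulr_natl ler_wpM2r ?mulr_ge0// ler_nat.
  exact: max_card.
- exact: tau_connected.
Qed.

Let total_weight t := \sum_i \sum_j W i j t.

(** With at least two agents, a connected graph has an arc between distinct
    ones, which adds eps to the total weight in each interval. *)
Lemma sampled_weight_ge p g : (1 < #|V|)%N ->
  g%:R * eps <= total_weight (tau (p + g)) - total_weight (tau p).
Proof.
move=> V1; elim: g => [|g IH]; first by rewrite addn0 subrr mul0r.
rewrite addnS mulrSr mulrDl mul1r.
suff : eps <= total_weight (tau (p + g).+1) - total_weight (tau (p + g)).
  by move: IH; lra.
move: (p + g)%N => q {IH}.
have W0 i j : 0 <= W i j (tau q.+1) - W i j (tau q).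
  by rewrite subr_ge0 W_le ?tau_ge0 ?tau_le.
have [r rconn] := tau_connected q.
have rT : [set r]%SET != [set: V]%SET.
  by apply/eqP => rT; move: V1; rewrite -cardsT -rT cards1.
have [j [i [_ _ /= eps_ij]]] := connect_exit (set11 r) rconn rT.
rewrite /total_weight -sumrB (bigD1 i)//= -sumrB (bigD1 j)//=.
rewrite -addrA (le_trans eps_ij)// lerDl addr_ge0// sumr_ge0// => k _.
by rewrite -sumrB sumr_ge0.
Qed.

(** If m intervals fitted into a window of length hbar, the total weight in this
    window would be at least m eps; the uniform bound excludes this for large
    m.  One more interval makes room for the growth phase. *)
Lemma sampling_gap :
  hbar = 0 \/ (1 < #|V|)%N /\ (exists C, forall t i j, 0 <= t ->
    W i j (t + hbar) - W i j t <= C) ->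
  exists g, [/\ (0 < g)%N, hbar = 0 -> g = 1%N &
    forall p, tau p.+1 + hbar <= tau (p + g)%N].
Proof.
have [hb0 _|/eqP hb0] := eqVneq hbar 0.
  by exists 1%N; split => // p; rewrite hb0 addr0 addn1.
move=> [//|[V1 [C HC]]].
have [m mC] : exists m : nat, \sum_(i : V) \sum_(j : V) C < m%:R * eps.
  exists (Num.truncn ((\sum_(i : V) \sum_(j : V) C) / eps)).+1.
  by rewrite -ltr_pdivrMr// truncnS_gt.
exists m.+1; split => // p; rewrite addnS -addSn leNgt; apply/negP => lt_tau.
have := sampled_weight_ge p.+1 m V1; rewrite leNgt => /negP; apply.
apply: le_lt_trans mC; rewrite /total_weight -sumrB; apply: ler_sum => i _.
rewrite -sumrB; apply: ler_sum => j _.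
apply: le_trans (HC (tau p.+1) i j (tau_ge0 _)); rewrite lerD2r.
by apply: W_le; rewrite ?tau_ge0// ltW.
Qed.

End sampling.

(** * Diameters, limits and bands *)

Lemma solution_trajectory tstar xstar phi x :
  solution hbar a h tstar xstar phi x -> trajectory tstar x.
Proof.
by move=> [_ _ acx dx]; split => // i T; exact: absolutely_continuous_ac.
Qed.

(** A single agent has no neighbours, so its derivative vanishes. *)
Lemma trajectory_const t0 x : #|V| = 1%N -> trajectory t0 x ->
  forall i t, t0 <= t -> x i t = x i t0.
Proof.
move=> V1 trx i t t0t.
have nojj (j : V) : (j != i) = false.
  apply/negbTE/negP => ji; have := max_card [set j; i]%SET.
  by rewrite cards2 ji V1.
have mono (k : R) : k * x i t0 + 0 <= k * x i t + 0.
  have [acx dx] := trajectory_affine k 0 trx.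
  apply: (ac_nondecreasing t0t (acx i t)).
  move: dx; apply: filterS.
    exact: (ae_filter_ringOfSetsType (@lebesgue_measure R)).
  move=> u dx /andP[t0u _]; exists 0 => //.
  by have := dx t0u i; rewrite big_pred0.
by have := mono 1; have := mono (- 1); lra.
Qed.

Lemma const_band t0 t x : #|V| = 1%N -> trajectory t0 x -> t0 + hbar <= t ->
  exists lam, in_band x t lam lam.
Proof.
move=> V1 trx t0t; have /card_gt0P[i0 _] : (0 < #|V|)%N by rewrite V1.
exists (x i0 t0) => i s s1 _.
have -> : i = i0 by apply: (fintype_le1P _); rewrite V1.
by rewrite (trajectory_const V1 trx) ?lexx//; move: t0t s1; lra.
Qed.

(** The initial function may be unbounded on a null set, but one delay after the
    start the window contains only values of the continuous solution. *)
Lemma band_exists t0 x : trajectory t0 x ->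
  exists lam Lam, lam <= Lam /\ in_band x (t0 + hbar) lam Lam.
Proof.
move=> [acx _].
have bnd i : exists K, 0 <= K /\ forall s, t0 <= s <= t0 + hbar -> `|x i s| <= K.
  by have [K K0 HK] := ac_bounded (acx i (t0 + hbar)); exists K.
have [K HK] := choice bnd.
have K0 : 0 <= \sum_i K i by apply: sumr_ge0 => i _; exact: (HK i).1.
exists (- \sum_i K i), (\sum_i K i); split; first by lra.
move=> i s; rewrite addrK => s1 s2; rewrite -ler_norml.
apply: le_trans ((HK i).2 s _) _; first by rewrite s1 s2.
by rewrite (bigD1 i)//= lerDl sumr_ge0// => j _; exact: (HK j).1.
Qed.

Lemma envelope_bounds x t i s : t - hbar <= s -> s <= t ->
  (lower_envelope hbar x t <= (x i s)%:E <= upper_envelope hbar x t)%E.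
Proof.
move=> s1 s2; apply/andP; split.
- apply: le_trans (bigmin_le _ i (fun i => (x i s)%:E)).
  by apply: ereal_inf_lbound; exists s => //=; rewrite in_itv/= s1.
- apply: le_trans (le_bigmax _ (fun i => (x i s)%:E) i) _.
  by apply: ereal_sup_ubound; exists s => //=; rewrite in_itv/= s1.
Qed.

Lemma diameter_le x t (lam Lam : R) : in_band x t lam Lam ->
  (diameter hbar x t <= (Lam - lam)%:E)%E.
Proof.
move=> band; rewrite EFinB; apply: leeB.
- apply: ge_ereal_sup => _ [s /= + <-]; rewrite in_itv/= => /andP[s1 s2].
  apply: (big_ind (fun u => (u <= Lam%:E)%E)) => [|u v uL vL|i _].
    exact: leNye.
    by rewrite ge_max uL.
  by rewrite lee_fin; have /andP[] := band i s s1 s2.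
- apply: le_ereal_inf_tmp => _ [s /= + <-]; rewrite in_itv/= => /andP[s1 s2].
  apply: (big_ind (fun u => (lam%:E <= u)%E)) => [|u v uL vL|i _].
    exact: leey.
    by rewrite le_min uL.
  by rewrite lee_fin; have /andP[] := band i s s1 s2.
Qed.

(** The envelopes lie on the two sides of a current value, so the difference is
    never an indeterminate form: it is infinite or the width of a real band. *)
Lemma diameter_band x t : (0 < #|V|)%N ->
  diameter hbar x t = +oo%E \/ exists lam Lam, [/\ lam <= Lam,
    in_band x t lam Lam & diameter hbar x t = (Lam - lam)%:E].
Proof.
move=> /card_gt0P[i0 _].
have env := @envelope_bounds x t.
have /andP[] := env i0 t ltac:(by rewrite gerBl) (lexx t).
rewrite /diameter.
case lowE: lower_envelope => [lam| |] //; case upE: upper_envelope => [Lam| |] //;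
  try by left.
rewrite !lee_fin => lam_le Lam_ge; right; exists lam, Lam; split => //.
  exact: le_trans lam_le Lam_ge.
by move=> i s s1 s2; have := env i s s1 s2; rewrite lowE upE !lee_fin.
Qed.

(** The current value and the limit both lie in the current band. *)
Lemma dist_limit_le_diameter t0 x xbar t : (0 < #|V|)%N ->
  0 <= t0 -> trajectory t0 x -> t0 <= t ->
  (forall i, x i t @[t --> +oo] --> xbar i) ->
  ((norm_infty (fun i => x i t - xbar i))%:E <= diameter hbar x t)%E.
Proof.
move=> V0 t00 trx t0t xlim.
have [->|[lam [Lam [lamLam band ->]]]] := diameter_band x t V0; first exact: leey.
have bandt i s : t <= s -> lam <= x i s <= Lam.
  move=> ts; apply: (in_band_forever t00 trx t0t band).
  by rewrite (le_trans _ ts)// gerBl.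
rewrite lee_fin /norm_infty; apply/bigmax_leP; split; first by rewrite subr_ge0.
move=> i _.
have near_band : \forall s \near +oo, lam <= x i s <= Lam.
  by near=> s; apply: bandt; near: s; apply: nbhs_pinfty_ge; exact: num_real.
have xcvg : cvg (x i t @[t --> +oo]) by apply/cvg_ex; exists (xbar i).
have xbarE : lim (x i t @[t --> +oo]) = xbar i by apply: cvg_lim => //; exact: xlim.
have lam_bar : lam <= xbar i.
  rewrite -xbarE; apply: limr_ge => //.
  by apply: filterS near_band => s /andP[].
have bar_Lam : xbar i <= Lam.
  rewrite -xbarE; apply: limr_le => //.
  by apply: filterS near_band => s /andP[].
have /andP[] := bandt i t (lexx t); rewrite ler_norml => h1 h2.
by apply/andP; split; lra.
Unshelve. all: by end_near. Qed.

(** It suffices to contract real bands: an infinite initial diameter makes the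
    estimate trivial because theta is positive. *)
Lemma contraction_of_bands (tau : nat -> R) (theta tstar : R) (r : nat) :
  (0 < #|V|)%N -> 0 < theta -> 0 <= tstar -> tstar <= tau r ->
  (forall p q, (p <= q)%N -> tau p <= tau q) ->
  (forall x lam Lam, trajectory tstar x -> lam <= Lam ->
     in_band x tstar lam Lam -> forall k, exists lam' Lam',
     in_band x (tau (r + 2 * k * (#|V| - 1))%N) lam' Lam' /\
     Lam' - lam' <= theta ^+ k * (Lam - lam)) ->
  contraction_estimate hbar a h tau theta tstar r.
Proof.
move=> V0 th0 tstar0 tstar_r tau_le bands xstar phi x xbar _ sol xlim k t.
move=> /andP[taut _]; have trx := solution_trajectory sol.
have tstar_k : tstar <= tau (r + 2 * k * (#|V| - 1))%N.
  by rewrite (le_trans tstar_r)// tau_le// leq_addr.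
split; first exact: (dist_limit_le_diameter V0 tstar0 trx (le_trans tstar_k taut)).
have [->|[lam [Lam [lamLam band ->]]]] := diameter_band x tstar V0.
  by rewrite gt0_muley ?leey// lte_fin exprn_gt0.
have [lam' [Lam' [band' width]]] := bands x lam Lam trx lamLam band k.
apply: le_trans (_ : ((Lam' - lam')%:E <= _)%E); last by rewrite -EFinM lee_fin.
by apply: diameter_le; exact: in_band_later tstar0 trx tstar_k taut band'.
Qed.

(** Bands are never left, so narrow bands give Cauchy's criterion for each agent
    and squeeze the limits together. *)
Lemma consensus_of_bands t0 x : 0 <= t0 -> trajectory t0 x ->
  (forall e, 0 < e -> exists t lam Lam,
     [/\ t0 <= t, in_band x t lam Lam & Lam - lam < e]) ->
  (forall i, cvg (x i t @[t --> +oo])) /\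
  (forall i j, lim (x i t @[t --> +oo]) = lim (x j t @[t --> +oo])).
Proof.
move=> t00 trx bands.
have bands' e : 0 < e -> exists t lam Lam, Lam - lam < e /\
    forall i s, t <= s -> lam <= x i s <= Lam.
  move=> /bands[t [lam [Lam [t0t band width]]]]; exists t, lam, Lam; split => //.
  move=> i s ts; apply: (in_band_forever t00 trx t0t band).
  by rewrite (le_trans _ ts)// gerBl.
have xcvg i : cvg (x i t @[t --> +oo]).
  apply: cauchy_cvg; apply: cauchy_exP => e /bands'[t [lam [Lam [width band]]]].
  exists (x i t).
  suff : \forall s \near +oo, ball (x i t) e (x i s) by [].
  near=> s; rewrite /ball/= ltr_norml.
  have /andP[? ?] := band i t (lexx t).
  have /andP[? ?] : lam <= x i s <= Lam.
    by apply: band; near: s; apply: nbhs_pinfty_ge; exact: num_real.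
  by apply/andP; split; lra.
split=> // i j; apply/eqP; rewrite -subr_eq0 -normr_le0; apply/ler_addgt0Pr => e e0.
have [t [lam [Lam [width band]]]] := bands' e e0.
have near_band k : \forall s \near +oo, lam <= x k s <= Lam.
  by near=> s; apply: band; near: s; apply: nbhs_pinfty_ge; exact: num_real.
have lim_band k : lam <= lim (x k t @[t --> +oo]) <= Lam.
  apply/andP; split; [apply: limr_ge => //|apply: limr_le => //].
    by apply: filterS (near_band k) => s /andP[].
  by apply: filterS (near_band k) => s /andP[].
have /andP[? ?] := lim_band i; have /andP[? ?] := lim_band j.
by rewrite add0r ler_norml; apply/andP; split; lra.
Unshelve. all: by end_near. Qed.

End trajectories.

(** * Consensus and the geometric rate *)

Lemma bernoulli_sub (R : realType) (u : R) (m : nat) :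
  0 <= u <= 1 -> 1 - m%:R * u <= (1 - u) ^+ m.
Proof.
move=> /andP[u0 u1]; elim: m => [|m IH]; first by rewrite mul0r subr0.
rewrite exprS; apply: le_trans (_ : (1 - u) * (1 - m%:R * u) <= _).
  have : 0 <= m%:R * u * u by rewrite !mulr_ge0.
  by rewrite mulrSr; lra.
by rewrite ler_wpM2l// subr_ge0.
Qed.

(** A factor c gained over m steps is a rate per step.  Bernoulli's inequality
    for theta = 1 - (1 - c) / m avoids taking m-th roots. *)
Lemma expr_root_bound (R : realType) (c : R) (m : nat) : (0 < m)%N ->
  0 < c < 1 -> exists theta, [/\ 0 < theta < 1, c <= theta & c <= theta ^+ m].
Proof.
move=> m0 /andP[c0 c1]; have m1 : 1 <= m%:R :> R by rewrite ler1n.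
have mp : 0 < m%:R :> R by rewrite ltr0n.
pose u := (1 - c) / m%:R.
have mu : m%:R * u = 1 - c by rewrite /u mulrC divfK ?gt_eqF.
have u0 : 0 < u by rewrite divr_gt0// subr_gt0.
have uc : u <= 1 - c by rewrite -mu ler_peMl// ltW.
exists (1 - u); split; [|lra|]; first by apply/andP; split; lra.
have := @bernoulli_sub _ u m; rewrite mu; move=> /(_ _)/wrap[]; last by lra.
by apply/andP; split; lra.
Qed.

Theorem theorem1 (R : realType) (V : finType) (hbar : R)
    (a h : V -> V -> R -> R) (tau : nat -> R) :
  0 <= hbar ->
  weight_functions a ->
  delay_functions hbar h ->
  (hbar = 0 \/ uniformly_bounded_windows a) ->
  aqsc_sequence a tau ->
  global_consensus hbar a h /\
  exists theta : R,
    [/\ 0 < theta < 1,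
        (forall tstar : R, 0 <= tstar -> exists r : nat,
           tstar <= tau r /\ contraction_estimate hbar a h tau theta tstar r) &
        (hbar = 0 \/ (2 <= #|V|)%N) ->
        exists sigma : nat -> nat,
          [/\ (forall p q : nat, (p < q)%N -> (sigma p < sigma q)%N),
              (hbar = 0 -> forall p : nat, sigma p = p),
              aqsc_sequence a (tau \o sigma) &
              forall (tstar : R) (r : nat),
                0 <= tstar -> tstar <= tau (sigma r) ->
                contraction_estimate hbar a h (tau \o sigma) theta tstar r]].
Proof.
move=> hbar0 a_ok h_ok hbar_or aqsc.
have [tau0 tau_lt tau_oo [eps eps0 tau_conn] [C HC]] := aqsc.
have a_ge0 i j (t : R) : 0 <= t -> 0 <= a i j t by exact: (a_ok i j).1.
have h_bnd i j (t : R) : 0 <= t -> 0 <= h i j t <= hbar by exact: (h_ok i j).1.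
have [W' HW'] := choice (fun ij : V * V =>
  weight_primitive (a_ge0 ij.1 ij.2) (a_ok ij.1 ij.2).2).
pose W i j := W' (i, j).
have W_int i j (s t : R) : 0 <= s -> s <= t ->
    weight_integral a s t i j = W i j t - W i j s.
  by have [H _ _ _] := HW' (i, j); exact: H.
have W_le i j (s t : R) : 0 <= s -> s <= t -> W i j s <= W i j t.
  by have [_ H _ _] := HW' (i, j); exact: H.
have W_ac i j (s t : R) : 0 <= s -> ac s t (W i j).
  by have [_ _ H _] := HW' (i, j); exact: H.
have W_derive i j : {ae lebesgue_measure, forall t : R, 0 < t ->
    is_derive t 1 (W i j) (a i j t)}.
  by have [_ _ _ H] := HW' (i, j); exact: H.
have tau_ge0 := tau_ge0 tau0 tau_lt.
have tau_le := tau_le tau_lt.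
have W_fun (s t : R) : 0 <= s -> s <= t ->
    weight_integral a s t = (fun i j => W i j t - W i j s).
  by move=> s0 st; apply/funext => i; apply/funext => j; exact: W_int.
have W_conn p : quasi_strongly_connected
    [rel j i | eps <= W i j (tau p.+1) - W i j (tau p)].
  by have := tau_conn p; rewrite /quasi_strongly_eps_connected W_fun// tau_le.
have V0 : (0 < #|V|)%N by have [i _] := W_conn 0%N; apply/card_gt0P; exists i.
have tau_past (M : R) : exists p, M <= tau p.
  by have /cvgryPge/(_ M)[p _ Hp] := tau_oo; exists p; apply: Hp => /=.
(* A single agent is constant, hence all bands after one delay have width 0;
   intervals may then be arbitrarily short compared with hbar. *)
have [V1|] := leqP #|V| 1.
  have {V0}V1 : #|V| = 1%N by apply/eqP; rewrite eqn_leq V1.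
  have estimate (r : nat) tstar : 0 <= tstar -> tstar + hbar <= tau r ->
      contraction_estimate hbar a h tau (1 / 2) tstar r.
    move=> tstar0 tstar_r.
    apply: (contraction_of_bands hbar0 a_ge0 h_bnd W_le W_ac W_derive) => //.
    - by rewrite V1.
    - by rewrite (le_trans _ tstar_r)// lerDl.
    move=> x lam Lam trx lamLam _ k.
    have [c band] := const_band V1 trx tstar_r.
    exists c, c; rewrite V1 subnn muln0 addn0; split => //.
    by rewrite subrr mulr_ge0 ?exprn_ge0 ?subr_ge0.
  split.
    move=> tstar xstar phi x tstar0 _ /solution_trajectory trx.
    apply: (consensus_of_bands hbar0 a_ge0 h_bnd W_le W_ac W_derive tstar0 trx).
    move=> e e0; have [c band] := const_band V1 trx (lexx (tstar + hbar)).
    by exists (tstar + hbar), c, c; split => //; [rewrite lerDl|rewrite subrr].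
  exists (1 / 2); split; first by apply/andP; split; lra.
    move=> tstar tstar0; have [r tstar_r] := tau_past (tstar + hbar).
    exists r; split; last exact: estimate.
    by rewrite (le_trans _ tstar_r)// lerDl.
  move=> [hb0|//].
  exists id; split => // tstar r tstar0 tstar_r.
  by apply: estimate => //; rewrite hb0 addr0.
move=> V1.
pose C0 := Num.max 0 C.
have C00 : 0 <= C0 by rewrite le_max lexx.
have W_C0 p i j : i != j -> W i j (tau p.+1) - W i j (tau p) <= C0.
  by move=> ij; rewrite -W_int ?tau_le// (le_trans (HC p i j ij))// le_max lexx orbT.
have [g [g0 g1 tau_g]] : exists g, [/\ (0 < g)%N, hbar = 0 -> g = 1%N &
    forall p, tau p.+1 + hbar <= tau (p + g)%N].
  apply: (sampling_gap W_le eps0 tau0 tau_lt W_conn).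
  have [hb0|/eqP hb0] := eqVneq hbar 0; [by left|right; split => //].
  have hb_gt0 : 0 < hbar by rewrite lt_neqAle eq_sym hbar0 andbT; exact/eqP.
  case: hbar_or => // /(_ hbar hb_gt0)[C1 HC1]; exists C1 => t i j t0.
  by rewrite -W_int ?lerDl//; exact: HC1.
have gp p : (p <= g * p)%N by rewrite leq_pmull.
have Cn0 : 0 <= #|V|%:R * (g%:R * C0) by rewrite !mulr_ge0.
set c := contraction_factor V (#|V|%:R * (g%:R * C0)) eps.
have c01 : 0 < c < 1 := contraction_factor_bounds V eps0 Cn0.
have c0 : 0 <= c by case/andP: c01 => /ltW.
have bands N q tstar x lam Lam k : (#|V| <= N)%N -> 0 <= tstar ->
    trajectory a h tstar x -> tstar <= tau (g * q)%N -> lam <= Lam ->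
    in_band hbar x (tau (g * q)%N) lam Lam -> exists lam' Lam',
    in_band hbar x (tau (g * (q + k * N))%N) lam' Lam' /\
    Lam' - lam' = c ^+ k * (Lam - lam).
  move=> VN tstar0 trx tstarq lamLam band.
  have cT := sampled_coarse_times tau_lt W_conn q C00 W_C0 tau_g.
  apply: (band_iterate hbar0 a_ge0 h_bnd W_le W_ac W_derive
    (T := fun p => tau (g * (q + p))%N) k eps0 Cn0 tstar0 trx _ cT lamLam _ VN).
  - by rewrite addn0.
  - by rewrite addn0.
split.
  move=> tstar xstar phi x tstar0 _ /solution_trajectory trx.
  apply: (consensus_of_bands hbar0 a_ge0 h_bnd W_le W_ac W_derive tstar0 trx).
  move=> e e0; have [lam [Lam [lamLam band]]] := band_exists hbar trx.
  have [q tstar_q'] := tau_past (tstar + hbar).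
  have tstar_q : tstar + hbar <= tau (g * q)%N.
    by rewrite (le_trans tstar_q')// tau_le.
  have tstar_hb : tstar <= tstar + hbar by rewrite lerDl.
  have tstar_gq := le_trans tstar_hb tstar_q.
  have bandq := in_band_later hbar0 a_ge0 h_bnd W_le W_ac W_derive
    tstar0 trx tstar_hb tstar_q band.
  have [k kD] : exists k, c ^+ k * (Lam - lam) < e.
    have cvg0 : c ^+ k * (Lam - lam) @[k --> \oo] --> 0 * (Lam - lam).
      apply: cvgMl; apply: cvg_expr; rewrite ger0_norm//.
      by case/andP: c01.
    move/cvgrPdist_lt: cvg0 => /(_ e e0)[k _ /(_ k (leqnn k))]; rewrite mul0r sub0r normrN.
    by exists k; apply: le_lt_trans (ler_norm _) _.
  have [lam' [Lam' [band' width]]] :=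
    bands _ q tstar x lam Lam k (leqnn _) tstar0 trx tstar_gq lamLam bandq.
  exists (tau (g * (q + k * #|V|))%N), lam', Lam'; split => //.
    by rewrite (le_trans tstar_gq)// tau_le// leq_mul2l leq_addr orbT.
  by rewrite width.
have gV0 : (0 < g * #|V|)%N by rewrite muln_gt0 g0.
have [theta [th01 c_th c_thm]] := expr_root_bound gV0 c01.
have /andP[th0 th1] := th01.
exists theta; split => //.
  move=> tstar tstar0; have [q tstar_q'] := tau_past tstar.
  have tstar_q : tstar <= tau (g * q)%N by rewrite (le_trans tstar_q')// tau_le.
  (* Starting n coarse intervals late makes up for the rounding down of
     2 k (n - 1) / (g n), the number of completed contractions. *)
  exists (g * (q + #|V|))%N.
  have tstar_r : tstar <= tau (g * (q + #|V|))%N.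
    by rewrite (le_trans tstar_q)// tau_le// leq_mul2l leq_addr orbT.
  split => //.
  apply: (contraction_of_bands hbar0 a_ge0 h_bnd W_le W_ac W_derive) => //.
  move=> x lam Lam trx lamLam band k.
  have bandq := in_band_later hbar0 a_ge0 h_bnd W_le W_ac W_derive
    tstar0 trx (lexx _) tstar_q band.
  pose j := ((2 * k * (#|V| - 1)) %/ (g * #|V|)).+1.
  have [lam' [Lam' [band' width]]] :=
    bands _ q tstar x lam Lam j (leqnn _) tstar0 trx tstar_q lamLam bandq.
  exists lam', Lam'; split.
    apply: (in_band_later hbar0 a_ge0 h_bnd W_le W_ac W_derive tstar0 trx _ _ band').
      by rewrite (le_trans tstar_q)// tau_le// leq_mul2l leq_addr orbT.
    apply: tau_le; rewrite /j mulSn !mulnDr -!addnA !leq_add2l.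
    by rewrite mulnCA leq_trunc_div.
  rewrite width ler_wpM2r ?subr_ge0//.
  apply: le_trans (_ : (theta ^+ (g * #|V|)) ^+ j <= _).
    by rewrite lerXn2r ?nnegrE ?exprn_ge0// ltW.
  rewrite -exprM ler_wiXn2l ?(ltW th0) ?(ltW th1)//.
  have : (2 * k * (#|V| - 1) < (g * #|V|) * j)%N by rewrite [ltnRHS]mulnC /j ltn_ceil.
  have : (k <= 2 * k * (#|V| - 1))%N.
    by rewrite mulnC mulnA leq_pmull// muln_gt0 subn_gt0 V1.
  by move=> h1 /ltnW; exact: leq_trans h1.
move=> _; exists (fun p => g * p)%N; split.
- by move=> p q pq; rewrite ltn_pmul2l.
- by move=> /g1 -> p; rewrite mul1n.
- split => //=.
  + by move=> p q pq; apply: tau_lt; rewrite ltn_pmul2l.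
  + apply/cvgryPge => M; have [p Mp] := tau_past M.
    exists p => // q /= pq; rewrite (le_trans Mp)// tau_le//.
    exact: leq_trans pq (gp q).
  + exists eps; first exact: eps0.
    move=> p; have := W_conn (g * p)%N.
    have gp_le : (g * p <= g * p.+1)%N by rewrite leq_mul2l leqnSn orbT.
    rewrite /quasi_strongly_eps_connected W_fun ?tau_le// => -[r rconn].
    exists r => v; have := rconn v; apply: connect_sub => j i /= eps_ij.
    apply: connect1 => /=; apply: le_trans eps_ij _; rewrite lerD2r W_le//.
    by apply: tau_le; rewrite mulnS addnC -addn1 leq_add2l.
  + exists (g%:R * C0) => p i j ij.
    have gp_le : (g * p <= g * p.+1)%N by rewrite leq_mul2l leqnSn orbT.
    rewrite W_int ?tau_le// mulnS addnC.
    by apply: sampled_weight_le => p'; exact: W_C0.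
- move=> tstar r tstar0 tstar_r.
  apply: (contraction_of_bands hbar0 a_ge0 h_bnd W_le W_ac W_derive) => //.
    by move=> p q pq /=; apply: tau_le; rewrite leq_mul2l pq orbT.
  move=> x lam Lam trx lamLam band k.
  have bandr := in_band_later hbar0 a_ge0 h_bnd W_le W_ac W_derive
    tstar0 trx (lexx _) tstar_r band.
  (* One block of the estimate contains the n coarse intervals of a
     contraction. *)
  have VN : (#|V| <= 2 * (#|V| - 1))%N by move: V1; clear; lia.
  have [lam' [Lam' [band' width]]] :=
    bands _ r tstar x lam Lam k VN tstar0 trx tstar_r lamLam bandr.
  exists lam', Lam'; split; first by rewrite /= -mulnA mulnCA.
  by rewrite width ler_wpM2r ?subr_ge0// lerXn2r ?nnegrE// ltW.
Qed.
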